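(* Let $d\ge 1$ be an integer and $\frac{d-1}{d}<\gamma\le 1$. There is a constant $C$ depending only on $d$ and $\gamma$ such that for every $\gamma$-Hölder charge $\boldsymbol{\omega}\in\operatorname{sch}^\gamma([0,1]^d)$ and every $B\in\mathcal{BV}([0,1]^d)$, $$|\boldsymbol{\omega}(B)|\le \frac{C\,\|\boldsymbol{\omega}\|_\gamma}{(\operatorname{isop}B)^{d(1-\gamma)}}\,|B|^\gamma .$$
   Context: $|E|$ denotes Lebesgue measure. For integrable $u:\mathbb{R}^d\to\mathbb{R}$, $\mathbf{V}u=\sup\{\int u\operatorname{div}v: v\in C^1_c(\mathbb{R}^d;\mathbb{R}^d),\ |v(x)|\le 1\ \forall x\}$. The perimeter of a measurable set $A$ is $\|A\|=\mathbf{V}\mathbf{1}_A$; a $BV$-set is a bounded measurable set of finite perimeter. $\mathcal{BV}([0,1]^d)$ is the collection of $BV$-subsets of $[0,1]^d$. The isoperimetric coefficient of a $BV$-set $B$ is $\operatorname{isop}B=|B|^{(d-1)/d}/\|B\|$. The quantity $|B|^\gamma/(\operatorname{isop}B)^{d(1-\gamma)}$ equals $\|B\|^{d(1-\gamma)}|B|^{d\gamma-(d-1)}$, and is read as the latter expression (hence as $0$) when $B$ is negligible. A sequence $(B_n)$ in $\mathcal{BV}([0,1]^d)$ $BV$-converges to $B$ if $|B_n\triangle B|\to0$ and $\sup_n\|B_n\|<\infty$. A charge on $[0,1]^d$ is a function $\boldsymbol{\omega}:\mathcal{BV}([0,1]^d)\to\mathbb{R}$ such that $\boldsymbol{\omega}(B_1\cup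 B_2)=\boldsymbol{\omega}(B_1)+\boldsymbol{\omega}(B_2)$ whenever $|B_1\cap B_2|=0$, and $\boldsymbol{\omega}(B_n)\to\boldsymbol{\omega}(B)$ whenever $(B_n)$ $BV$-converges to $B$. A dyadic cube is a set $\prod_{i=1}^d[2^{-n}k_i,2^{-n}(k_i+1)]$ with integers $n\ge0$, $0\le k_i\le 2^n-1$. A charge is $\gamma$-Hölder if $\|\boldsymbol{\omega}\|_\gamma:=\sup\{|\boldsymbol{\omega}(K)|/|K|^\gamma: K\text{ dyadic cube}\}<\infty$; $\operatorname{sch}^\gamma([0,1]^d)$ is the space of $\gamma$-Hölder charges. *)

(* Defs.v *)
From HB Require Import structures.
From mathcomp Require Import all_boot all_order all_algebra.
From mathcomp Require Import all_classical all_reals all_analysis.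

Set Implicit Arguments.
Unset Strict Implicit.
Unset Printing Implicit Defensive.

Import Order.TTheory GRing.Theory Num.Theory.
Import numFieldNormedType.Exports.

Local Open Scope classical_set_scope.
Local Open Scope ring_scope.

Section LebesgueMeasure.
Context (R : realType) (d : nat).

(* A closed box is given by its two extreme corners.  [None] is the empty box:
   without it the empty set could not be covered by boxes of volume 0 when
   d = 0. *)
Definition box : Type := option ('rV[R]_d * 'rV[R]_d).

Definition box_set (Q : box) : set 'rV[R]_d :=
  if Q is Some (a, b) then [set x | forall i, a 0 i <= x 0 i <= b 0 i]
  else set0.

Definition box_vol (Q : box) : R :=
  if Q is Some (a, b) then \prod_i Num.max 0 (b 0 i - a 0 i) else 0.

Definition lebesgue_outer (A : set 'rV[R]_d) : \bar R :=
  ereal_inf [set (\sum_(k <oo) (box_vol (Q k))%:E)%E |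
             Q in [set Q : nat -> box | A `<=` \bigcup_k box_set (Q k)]].

Local Open Scope ereal_scope.

Lemma box_vol_ge0 (Q : box) : 0 <= (box_vol Q)%:E.
Proof.
rewrite lee_fin; case: Q => [[a b]|//] /=.
by apply: prodr_ge0 => i _; rewrite le_max lexx.
Qed.

Lemma lebesgue_outer_ge0 A : 0 <= lebesgue_outer A.
Proof.
apply: le_ereal_inf_tmp => _ [Q _ <-].
by apply: nneseries_ge0 => k _ _; exact: box_vol_ge0.
Qed.

Lemma lebesgue_outer0 : lebesgue_outer set0 = 0.
Proof.
apply/eqP; rewrite eq_le lebesgue_outer_ge0 andbT.
apply: ereal_inf_lbound; exists (fun=> None) => //.
by rewrite eseries0.
Qed.

Lemma le_lebesgue_outer : {homo lebesgue_outer : A B / A `<=` B >-> A <= B}.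
Proof.
move=> A B AB; apply/ereal_inf_le_tmp => _ [Q BQ <-].
by exists Q => //; exact: subset_trans AB BQ.
Qed.

Lemma lebesgue_outer_sigma_subadditive : sigma_subadditive lebesgue_outer.
Proof.
move=> A; have [[i ioo]|] := pselect (exists i, lebesgue_outer (A i) = +oo).
  rewrite (eseries_pinfty _ _ ioo) ?leey// => n _.
  by rewrite -ltNye (lt_le_trans _ (lebesgue_outer_ge0 _)).
rewrite -forallNE => Aoo.
suff add2e (e : {posnum R}) : lebesgue_outer (\bigcup_n A n) <=
    \sum_(i <oo) lebesgue_outer (A i) + e%:num%:E.
  by apply/lee_addgt0Pr => _/posnumP[].
rewrite (le_trans _ (epsilon_trick _ _ _))//; last first.
  by move=> n; exact: lebesgue_outer_ge0.
pose P n (Q : nat -> box) := A n `<=` \bigcup_k box_set (Q k) /\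
  \sum_(k <oo) (box_vol (Q k))%:E <=
  lebesgue_outer (A n) + (e%:num / (2 ^ n.+1)%:R)%:E.
have [G PG] : {G : nat -> nat -> box & forall n, P n (G n)}.
  apply: (@choice _ _ P) => n; rewrite /P.
  have en1 : (0 < e%:num / (2 ^ n.+1)%:R)%R by [].
  have fA : lebesgue_outer (A n) \is a fin_num.
    rewrite ge0_fin_numE ?lebesgue_outer_ge0// ltey.
    exact/eqP/Aoo.
  have [_ [Q AQ <-] /ltW ?] := lb_ereal_inf_adherent en1 fA.
  by exists Q.
pose v (p : nat * nat) := (box_vol (G p.1 p.2))%:E.
have v_ge0 p : 0 <= v p by exact: box_vol_ge0.
apply: (@le_trans _ _ (\esum_(p in setT) v p)).
  apply: ereal_inf_lbound => /=.
  have /card_esym/ppcard_eqP[f] := card_nat2.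
  exists (fun k => G (f k).1 (f k).2).
    move=> x [n _ /(PG n).1 [j _ xj]]; exists (f^-1%FUN (n, j)) => //=.
    by rewrite invK ?inE.
  rewrite -(esum_pred_image v _ xpredT) ?[fun=> _]set_true//.
  by rewrite image_eq.
rewrite (_ : esum _ _ = \sum_(i <oo) \sum_(j <oo) v (i, j)); last first.
  pose J : nat -> set (nat * nat) := fun i => [set (i, j) | j in setT].
  rewrite (_ : setT = \bigcup_k J k); last first.
    by rewrite predeqE => -[a b]; split => // _; exists a => //; exists b.
  rewrite esum_bigcupT /=; last 2 first.
    - apply/trivIsetP => i j _ _ ij.
      rewrite predeqE => -[n m] /=; split => //= -[] [_] _ [<-{n} _].
      by move=> [m' _] [] /esym/eqP; rewrite (negbTE ij).
    - by move=> p; exact: v_ge0.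
  rewrite -(image_id [set: nat]) -fun_true esum_pred_image//; last first.
    by move=> n _; exact: esum_ge0.
  apply: eq_eseriesr => /= j _.
  rewrite -(esum_pred_image v (pair j) predT)//=; last first.
    by move=> ? ? _ _; exact: (@can_inj _ _ _ snd).
  by congr esum; rewrite predeqE => -[a b]; split; move=> [i _ <-]; exists i.
apply: lee_nneseries => [i _ _|i _]; last exact: (PG i).2.
by apply: nneseries_ge0 => m _ _; exact: v_ge0.
Qed.

HB.instance Definition _ := isOuterMeasure.Build R 'rV[R]_d lebesgue_outer
  lebesgue_outer0 lebesgue_outer_ge0 le_lebesgue_outer
  lebesgue_outer_sigma_subadditive.

End LebesgueMeasure.

(* R^d with the sigma-algebra of Lebesgue measurable sets *)
Notation lebesgue_type R d := (caratheodory_type (@lebesgue_outer R d)).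

Section LebesgueMeasureInstance.
Context (R : realType) (d : nat).

Definition leb : set (lebesgue_type R d) -> \bar R := @lebesgue_outer R d.

HB.instance Definition _ := isMeasure.Build _ (lebesgue_type R d) R leb
  (@caratheodory_measure0 _ _ _) (@caratheodory_measure_ge0 _ _ _)
  (@caratheodory_measure_sigma_additive _ _ _).

End LebesgueMeasureInstance.

Section BVSets.
Context (R : realType) (d : nat).
Implicit Types (A B : set 'rV[R]_d) (v : 'rV[R]_d -> 'rV[R]_d).

(* The library norm on row vectors is the max norm. *)
Definition euclidean_norm (x : 'rV[R]_d) : R := Num.sqrt (\sum_i x 0 i ^+ 2).

Definition divergence v (x : 'rV[R]_d) : R :=
  \sum_i 'D_(delta_mx 0 i) (fun y => v y 0 i) x.

Definition continuously_differentiable v :=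
  (forall x, differentiable v x) /\ continuous (jacobian v).

Definition compactly_supported v := compact (closure [set x | v x != 0]).

Definition test_field v :=
  [/\ continuously_differentiable v, compactly_supported v &
      forall x, euclidean_norm (v x) <= 1].

Definition total_var (u : 'rV[R]_d -> R) : \bar R :=
  ereal_sup [set (\int[@leb R d]_x (u x * divergence v x)%:E)%E |
             v in test_field].

Definition perimeter A : \bar R := total_var \1_A.

Definition bv_set A :=
  [/\ bounded_set A, measurable (A : set (lebesgue_type R d)) &
      (perimeter A < +oo)%E].

Definition unit_cube : set 'rV[R]_d :=
  [set x : 'rV[R]_d | forall i, 0 <= x 0 i <= 1].

Definition bv_cube : set (set 'rV[R]_d) :=
  [set B | bv_set B /\ B `<=` unit_cube].

Definition vol B : R := fine (leb B).

Definition per B : R := fine (perimeter B).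

Definition isop B : R := vol B `^ ((d%:R - 1) / d%:R) / per B.

(* |B|^gamma / (isop B)^(d(1-gamma)), with its meaning for negligible B. *)
Definition isop_ratio (gamma : R) B : R :=
  if vol B == 0 then
    per B `^ (d%:R * (1 - gamma)) * vol B `^ (d%:R * gamma - (d%:R - 1))
  else vol B `^ gamma / isop B `^ (d%:R * (1 - gamma)).

Definition bv_cvg (B_ : nat -> set 'rV[R]_d) B :=
  (leb (B_ n `+` B) @[n --> \oo] --> 0%E) /\
  (ereal_sup (range (perimeter \o B_)) < +oo)%E.

(* A charge is represented by a total function on sets, whose values outside
   [bv_cube] are irrelevant. *)
Definition charge_on_cube (omega : set 'rV[R]_d -> R) :=
  (forall B1 B2, bv_cube B1 -> bv_cube B2 -> leb (B1 `&` B2) = 0%E ->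
     omega (B1 `|` B2) = omega B1 + omega B2) /\
  (forall (B_ : nat -> set 'rV[R]_d) B, (forall n, bv_cube (B_ n)) ->
     bv_cube B -> bv_cvg B_ B -> omega (B_ n) @[n --> \oo] --> omega B).

Definition dyadic_cube : set (set 'rV[R]_d) :=
  [set K | exists (n : nat) (k : 'I_d -> nat),
     (forall i, (k i <= 2 ^ n - 1)%N) /\
     K = [set x : 'rV[R]_d | forall i,
            (k i)%:R / 2 ^+ n <= x 0 i <= ((k i).+1)%:R / 2 ^+ n]].

Definition holder_norm (gamma : R) (omega : set 'rV[R]_d -> R) : \bar R :=
  ereal_sup [set (`|omega K| / vol K `^ gamma)%:E | K in dyadic_cube].

Definition sch (gamma : R) : set (set 'rV[R]_d -> R) :=
  [set omega | charge_on_cube omega /\ (holder_norm gamma omega < +oo)%E].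

End BVSets.

(* Main.v *)
Require Import Defs.
From HB Require Import structures.
From mathcomp Require Import all_boot all_order all_algebra.
From mathcomp Require Import all_classical all_reals all_analysis.
From mathcomp Require Import measurable_realfun ring lra zify.

(* Write [a n k] for the density of a set in the cell [k] of the dyadic grid of
   mesh [2^-n].  Replacing a charge on a figure by the sums [\sum_k a n k * omega
   (cell k)], two consecutive sums differ by at most
   [2^-(n d gamma) * \sum_k \sum_i |a n (k + e_i) - a n k|], and this discrete
   variation is at most [2^(n (d - 1))] times the perimeter (test the perimeter
   against smoothed indicators of the cells).  As [d gamma > d - 1] the
   differences form a convergent geometric series, and the sum at the mesh
   [2^-n ~ |B| / ||B||] is bounded directly.  For a general BV set [B], the
   superlevel sets of [a n] at a level [t] in [[1/3, 2/3]] converge to [B]; averaging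
   over [t] gives levels for which their perimeters are at most a constant times
   [||B||], so the bound for figures passes to the limit. *)

Set Implicit Arguments.
Unset Strict Implicit.
Unset Printing Implicit Defensive.

Import Order.TTheory GRing.Theory Num.Theory.
Import numFieldNormedType.Exports.

Local Open Scope classical_set_scope.
Local Open Scope ring_scope.

(** The Hölder bound controls one cube at a time. Added up over all cells of mesh [h] it costs about
    [h^(d gamma - d)], which blows up when [gamma < 1]. The remedy is to compare consecutive meshes:
    the density of a cell is the mean of the densities of its children, so a cell contributes only
    as far as the density varies inside it. Closeness in measure does not suffice for the passage to
    the limit, since a charge is continuous only along sequences of bounded perimeter. Hence two
    approximations: figures made of the cells that meet a cover of [B], close to [B] but with
    uncontrolled perimeter, and superlevel figures, shown to be close to the former. Keeping the
    level at distance [1/3] from 0 and 1 forces a misclassified cell to have a third of its volume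
    in the error set; this is the source of the factors 3. At mesh [h] the two terms of the estimate
    are of order [|B| h^(-d (1 - gamma))] and [||B|| h^(1 - d (1 - gamma))]. They balance at
    [h = |B| / ||B||], where both are the required ratio. *)

Definition cbox (R : realType) (d : nat) (a b : 'rV[R]_d) : set 'rV[R]_d :=
  [set x | forall i, a 0 i <= x 0 i <= b 0 i].

Definition lmeasurable (R : realType) (d : nat) (A : set 'rV[R]_d) : Prop :=
  measurable (A : set (lebesgue_type R d)).

(** * Lebesgue measure of boxes and grid cells *)

Section Lebesgue.
Context (R : realType) (d : nat).
Implicit Types (A B : set 'rV[R]_d) (a b x : 'rV[R]_d) (i : 'I_d).

Lemma leb_ge0 A : (0 <= leb A)%E.
Proof. exact: lebesgue_outer_ge0. Qed.

Lemma le_leb A B : A `<=` B -> (leb A <= leb B)%E.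
Proof. exact: le_lebesgue_outer. Qed.

Lemma lebU_le A B : (leb (A `|` B) <= leb A + leb B)%E.
Proof. exact: outer_measureU2. Qed.

Lemma leb_cbox_le a b :
  (leb (cbox a b) <= (\prod_i Num.max 0 (b 0 i - a 0 i))%:E)%E.
Proof.
apply: ereal_inf_lbound.
exists (fun k => if (k == 0)%N then Some (a, b) else None : box R d).
  by move=> x xab; exists 0%N.
rewrite (nneseries_split 0 1)//; last by move=> k _; exact: box_vol_ge0.
rewrite big_mkord big_ord1/= eseries0 ?adde0//.
by case.
Qed.

Lemma leb_cbox0 a b i : b 0 i <= a 0 i -> (leb (cbox a b) = 0)%E.
Proof.
move=> ba; apply/eqP; rewrite eq_le leb_ge0 andbT.
rewrite (le_trans (leb_cbox_le _ _))//.
by rewrite (bigD1 i)//= max_l ?mul0r// subr_le0.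
Qed.

Definition row_with x i (c : R) : 'rV[R]_d :=
  \row_j (if j == i then c else x 0 j).

Definition box_le (Q : box R d) i (c : R) : box R d :=
  omap (fun ab => (ab.1, row_with ab.2 i (Num.min (ab.2 0 i) c))) Q.

Definition box_ge (Q : box R d) i (c : R) : box R d :=
  omap (fun ab => (row_with ab.1 i (Num.max (ab.1 0 i) c), ab.2)) Q.

(** The truncations by [min] and [max] keep the identity true when [c] lies outside the side of the
    box: one of the two pieces then has volume 0. *)
Lemma box_vol_split Q i c :
  box_vol Q = box_vol (box_le Q i c) + box_vol (box_ge Q i c).
Proof.
case: Q => [[a b]|]/=; last by rewrite addr0.
rewrite [LHS](bigD1 i)//= [X in _ = X + _](bigD1 i)//= [X in _ = _ + X](bigD1 i)//=.
rewrite !mxE eqxx.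
under [X in _ = _ * X + _]eq_bigr => j ji do rewrite mxE (negbTE ji).
under [X in _ = _ + _ * X]eq_bigr => j ji do rewrite mxE (negbTE ji).
rewrite -mulrDl; congr (_ * _).
rewrite /Num.max /Num.min.
case: (ltP (b 0 i) c) => ?; case: (ltP (a 0 i) c) => ?;
  repeat case: ltP => ?; lra.
Qed.

(** Cutting every box of a cover of [X] along the hyperplane gives covers of the two parts of [X]
    with the same total volume, which is the Carathéodory inequality. *)
Lemma lmeasurable_halfspace i c : lmeasurable [set x : 'rV[R]_d | x 0 i <= c].
Proof.
apply: le_caratheodory_measurable => X.
apply: le_ereal_inf_tmp => _ [Q XQ <-].
under eq_eseriesr do rewrite (box_vol_split _ i c) EFinD.
rewrite nneseriesD; [|by move=> *; exact: box_vol_ge0..].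
apply: leeD.
- apply: ereal_inf_lbound; exists (fun k => box_le (Q k) i c) => // x [/XQ].
  move=> [k _]; rewrite /box_set; case Qk : (Q k) => [[a b]|]//= xab xc.
  exists k => //; rewrite Qk/= => j; rewrite mxE; case: eqP => [->|_]; last exact: xab.
  by have /andP[-> xb] := xab i; rewrite le_min xb.
- apply: ereal_inf_lbound; exists (fun k => box_ge (Q k) i c) => // x [/XQ].
  move=> [k _]; rewrite /box_set; case Qk : (Q k) => [[a b]|]//= xab xc.
  exists k => //; rewrite Qk/= => j; rewrite mxE; case: eqP => [->|_]; last exact: xab.
  have /andP[ax ->] := xab i; rewrite ge_max ax/= andbT ltW// ltNge.
  exact/negP.
Qed.

Lemma leb_setIC A X : lmeasurable A -> (leb X = leb (X `&` A) + leb (X `&` ~` A))%E.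
Proof. by move/(_ X). Qed.

Lemma lmeasurableC A : lmeasurable A -> lmeasurable (~` A).
Proof. exact: measurableC. Qed.

Lemma lmeasurableI A B : lmeasurable A -> lmeasurable B -> lmeasurable (A `&` B).
Proof. exact: measurableI. Qed.

Lemma lmeasurableU A B : lmeasurable A -> lmeasurable B -> lmeasurable (A `|` B).
Proof. exact: measurableU. Qed.

Lemma lmeasurableD A B : lmeasurable A -> lmeasurable B -> lmeasurable (A `\` B).
Proof. exact: measurableD. Qed.

Lemma lmeasurable0 : lmeasurable (set0 : set 'rV[R]_d).
Proof. exact: measurable0. Qed.

Lemma lmeasurable_lt i c : lmeasurable [set x : 'rV[R]_d | x 0 i < c].
Proof.
rewrite (_ : [set _ | _] =
    \bigcup_n [set x : 'rV_d | x 0 i <= c - n.+1%:R^-1]); last first.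
  apply/seteqP; split => x /=.
    move=> xc; have cx : 0 < c - x 0 i by rewrite subr_gt0.
    have [n Hn] := ltr_add_invr cx; exists n => //=.
    by rewrite lerBrDr -lerBrDl ltW//; move: Hn; rewrite add0r.
  move=> [n _]/= /le_lt_trans; apply.
  by rewrite ltrBlDr ltrDl invr_gt0.
by apply: bigcup_measurable => n _; exact: lmeasurable_halfspace.
Qed.

Lemma lmeasurable_cbox a b : lmeasurable (cbox a b).
Proof.
rewrite (_ : cbox a b = \bigcap_(i : 'I_d)
    ([set x : 'rV[R]_d | x 0 i <= b 0 i] `&` ~` [set x : 'rV[R]_d | x 0 i < a 0 i])); last first.
  apply/seteqP; split => x /=.
    by move=> xab i _/=; have /andP[ax xb] := xab i; split => //; apply/negP; rewrite -leNgt.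
  by move=> xab i; have [-> /negP] := xab i I; rewrite -leNgt => ->.
apply: fin_bigcap_measurable => // i _; apply: lmeasurableI.
  exact: lmeasurable_halfspace.
exact/lmeasurableC/lmeasurable_lt.
Qed.

Lemma leb_shift_le A x : (leb [set y : 'rV[R]_d | A (y + x)%R] <= leb A)%E.
Proof.
apply: le_ereal_inf_tmp => _ [Q AQ <-].
pose T := omap (fun ab : 'rV[R]_d * 'rV[R]_d => (ab.1 - x, ab.2 - x)).
apply: ereal_inf_lbound; exists (T \o Q) => [y /AQ[k _ Qy]|].
  exists k => //=; case: (Q k) Qy => [[a b]|]//= Qy i.
  by have := Qy i; rewrite !mxE lerBlDr lerBrDr.
apply: eq_eseriesr => k _ /=; case: (Q k) => [[a b]|]//=.
by congr (_%:E); apply: eq_bigr => i _; rewrite !mxE opprB addrA subrK.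
Qed.

Lemma leb_shift A x : (leb [set y : 'rV[R]_d | A (y + x)%R] = leb A)%E.
Proof.
apply/eqP; rewrite eq_le leb_shift_le/=.
have := leb_shift_le [set y : 'rV[R]_d | A (y + x)%R] (- x); apply: le_trans.
by apply: le_leb => y /=; rewrite subrK.
Qed.

Lemma lmeasurable_shift A x : lmeasurable A -> lmeasurable [set y : 'rV[R]_d | A (y + x)%R].
Proof.
move=> mA; apply: le_caratheodory_measurable => X.
change (leb (X `&` [set y : 'rV[R]_d | A (y + x)%R]) +
  leb (X `&` ~` [set y : 'rV[R]_d | A (y + x)%R]) <= leb X)%E.
rewrite -(leb_shift X (- x)).
rewrite [leRHS](leb_setIC _ mA) -[X in (_ <= X + _)%E](leb_shift _ x) -[X in (_ <= _ + X)%E](leb_shift _ x).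
by apply: leeD; apply: le_leb => y /=; rewrite addrK.
Qed.

(** Keys are integer vectors, so that the neighbours [k + e_i] and [k - e_i] exist even at the
    border of the cube. *)
Definition cell (h : R) (k : 'rV[int]_d) : set 'rV[R]_d :=
  [set x | forall i, (k 0 i)%:~R * h <= x 0 i <= (k 0 i + 1)%:~R * h].

Lemma cell_cbox h k : cell h k =
  cbox (\row_i ((k 0 i)%:~R * h)) (\row_i ((k 0 i + 1)%:~R * h)).
Proof. by apply/seteqP; split => x kx i; have := kx i; rewrite !mxE. Qed.

Lemma lmeasurable_cell h k : lmeasurable (cell h k).
Proof. by rewrite cell_cbox; exact: lmeasurable_cbox. Qed.

Lemma leb_cell_le h k : 0 <= h -> (leb (cell h k) <= (h ^+ d)%:E)%E.
Proof.
move=> h0; rewrite cell_cbox (le_trans (leb_cbox_le _ _))// lee_fin.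
rewrite (eq_bigr (fun=> h)) ?prodr_const ?card_ord// => i _.
by rewrite !mxE -mulrBl -rmorphB/= addrAC subrr add0r mul1r max_r.
Qed.

Lemma cell_exists h x : 0 < h -> exists k, cell h k x.
Proof.
move=> h0; exists (\row_i Num.floor (x 0 i / h)) => i; rewrite mxE.
rewrite -ler_pdivlMr// -[X in _ && X]ler_pdivrMr// floor_le_tmp/=.
by rewrite ltW// floorD1_gt.
Qed.

Lemma cell_dist h k x y j : cell h k x -> cell h k y -> `|x 0 j - y 0 j| <= h.
Proof.
move=> /(_ j) + /(_ j); rewrite intrD mulrDl mul1r.
by move=> /andP[? ?] /andP[? ?]; rewrite ler_norml; apply/andP; split; lra.
Qed.

Lemma lmeasurable_open A : open A -> lmeasurable A.
Proof.
move=> oA.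
pose C (p : nat * 'rV[int]_d) := cell p.1.+1%:R^-1 p.2.
(* The second factor does not depend on the point: it keeps [C p] when this cell lies in [A] and
   empties it otherwise. *)
rewrite (_ : A = \bigcup_p (C p `&` [set _ | C p `<=` A])); last first.
  apply/seteqP; split => x /=; last by move=> [p _ [Cp]]; exact.
  rewrite openE in oA; move=> /oA/nbhs_ballP[e/= e0 xeA].
  have [n] := ltr_add_invr e0; rewrite add0r => ne.
  have n0 : 0 < n.+1%:R^-1 :> R by rewrite invr_gt0.
  have [k kx] := cell_exists x n0; exists (n, k) => //; split => //= y ky.
  apply: xeA; split => // i j; rewrite (ord1 i).
  by rewrite /ball/= (le_lt_trans (cell_dist j kx ky)).
apply: (@countable_bigcupT_measurable _ (lebesgue_type R d) _ _ (@countableP (nat * 'rV[int]_d)%type _)) => p.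
have [pA|pA] := pselect (C p `<=` A).
  rewrite (_ : [set _ | _] = setT) ?setIT; last by apply/seteqP; split.
  exact: lmeasurable_cell.
by rewrite (_ : [set _ | _] = set0) ?setI0//; apply/seteqP; split.
Qed.

Lemma lmeasurable_continuous (f : 'rV[R]_d -> R) D : lmeasurable D ->
  continuous f -> measurable_fun (D : set (lebesgue_type R d)) f.
Proof.
move=> mD /continuousP cf; apply: (measurability _ (RGenOpens.measurableE R)) => _ [_ [x [y ->]] <-].
by apply: measurableI => //; have oV := cf _ (@interval_open _ (BRight x) (BLeft y) isT isT); exact: (lmeasurable_open oV).
Qed.

(** An interval holds at most one more grid point than its length divided by the step. This serves
    twice: for grid points in boxes, and for levels between two densities. *)
Lemma count_grid (t al be : R) (M : nat) : 0 < t ->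
  t * \sum_(l < M) (al <= l%:R * t <= be)%R%:R <= Num.max 0 (be - al) + t.
Proof.
move=> t0.
(* The induction on [M] needs a bound that grows with [M]: the interval is cut at the last grid
   point [(M - 1) t]. *)
suff H : t * \sum_(l < M) (al <= l%:R * t <= be)%R%:R <=
    Num.max 0 (Num.min be ((M%:R - 1) * t) - al + t).
  apply: (le_trans H); rewrite ge_max addr_ge0 ?le_max ?lexx ?(ltW t0)//= lerD2r le_max.
  by apply/orP; right; rewrite lerD2r ge_min lexx.
elim: M => [|M IH]; first by rewrite big_ord0 mulr0 le_max lexx.
rewrite big_ord_recr/= mulrDr -natr1 addrK.
have {IH} := IH; set S := t * \sum_(_ < _) _; move: S => S.
have -> : (M%:R - 1) * t = M%:R * t - t by rewrite mulrBl mul1r.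
move: (M%:R * t) => u.
have [au|ua] := leP al u; last first.
  have : Num.min be (u - t) <= u - t by rewrite ge_min lexx orbT.
  rewrite andFb mulr0 addr0 !le_max => ? /orP[->//|?].
  by apply/orP; left; lra.
have [ub|bu] := leP u be => /=; last first.
  have : Num.min be (u - t) <= be by rewrite ge_min lexx.
  rewrite mulr0 addr0 !le_max => ? /orP[->//|?].
  by apply/orP; right; lra.
rewrite min_r; last lra.
by rewrite mulr1 !le_max => /orP[?|?]; apply/orP; right; lra.
Qed.

End Lebesgue.

Section Lebesgue.
Context (R : realType) (d : nat).
Implicit Types (A B : set 'rV[R]_d) (a b x : 'rV[R]_d) (i : 'I_d).

Lemma cvg_prod_shift (c : 'I_d -> R) :
  \prod_i (c i + s) @[s --> (0 : R)] --> \prod_i c i.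
Proof.
have -> : \prod_i c i = \prod_i (c i + 0) by apply: eq_bigr => i _; rewrite addr0.
apply: cvg_big => [|i _]; first exact: mul_continuous.
by apply: cvgD; [exact: cvg_cst|exact: cvg_id].
Qed.

(* Counts the points of a grid of step [h / M] lying in each box, then lets [M]
   tend to infinity: this avoids any partition of the boxes. *)
Lemma cell_cover_le (h : R) (k : 'rV[int]_d) (N : nat) (a b : 'I_N -> 'rV[R]_d) :
  0 < h -> cell h k `<=` [set x | exists n, cbox (a n) (b n) x] ->
  h ^+ d <= \sum_n \prod_i Num.max 0 (b n 0 i - a n 0 i).
Proof.
move=> h0 cov.
(* [G s] is the total volume after lengthening every side by [s]; by [count_grid] this is what
   counting at step [s] can prove. *)
pose G s := \sum_n \prod_i (Num.max 0 (b n 0 i - a n 0 i) + s).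
have cG : G s @[s --> (0 : R)] --> \sum_n \prod_i Num.max 0 (b n 0 i - a n 0 i).
  by apply: cvg_big => [|n _]; [exact: add_continuous|exact: cvg_prod_shift].
have cG' : (G \o (fun M => h * M.+1%:R^-1)) M @[M --> \oo] -->
    \sum_n \prod_i Num.max 0 (b n 0 i - a n 0 i).
  apply: cvg_comp cG; rewrite -(mulr0 h).
  by apply: cvgM; [exact: cvg_cst|exact: cvg_harmonic].
apply: (cvgr_to_ge cG'); apply: nearW => M /=.
have t0 : 0 < h * M.+1%:R^-1 by rewrite mulr_gt0// invr_gt0.
set t := h * _ in t0 *.
have ht : h = M.+1%:R * t by rewrite /t mulrC mulfVK.
pose p (f : {ffun 'I_d -> 'I_M.+1}) : 'rV[R]_d := \row_i ((k 0 i)%:~R * h + (f i)%:R * t).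
pose ind n (f : {ffun 'I_d -> 'I_M.+1}) i : R :=
  (a n 0 i <= p f 0 i <= b n 0 i)%R%:R.
have pcell f : cell h k (p f).
  move=> i; rewrite mxE intrD mulrDl mul1r lerDl lerD2l mulr_ge0 ?(ltW t0)//=.
  by rewrite [in leRHS]ht ler_pM2r// ler_nat ltnW.
have ind_sum f : 1 <= \sum_n \prod_i ind n f i.
  have [n pn] := cov _ (pcell f); rewrite (bigD1 n)//=.
  rewrite big1 ?lerDl; last by move=> i _; rewrite /ind pn.
  by apply: sumr_ge0 => m _; apply: prodr_ge0.
have -> : h ^+ d = \sum_(f : {ffun 'I_d -> 'I_M.+1}) t ^+ d.
  by rewrite sumr_const card_ffun !card_ord -mulr_natl natrX -exprMn -ht.
apply: (@le_trans _ _ (\sum_f \sum_n t ^+ d * \prod_i ind n f i)).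
  apply: ler_sum => f _; rewrite -mulr_sumr ler_peMr//.
  by rewrite exprn_ge0 ?ltW.
rewrite exchange_big/=; apply: ler_sum => n _.
(* Grid points are functions from coordinates to indices, so the count of those in a box factors
   into one count per coordinate. *)
have -> : \sum_f t ^+ d * \prod_i ind n f i =
    \prod_i (t * \sum_(l < M.+1) (a n 0 i - (k 0 i)%:~R * h <= l%:R * t <= b n 0 i - (k 0 i)%:~R * h)%R%:R).
  rewrite big_split/= prodr_const card_ord -mulr_sumr bigA_distr_bigA/=.
  congr (_ * _); apply: eq_bigr => f _; apply: eq_bigr => i _.
  by rewrite /ind mxE lerBlDl lerBrDl.
apply: ler_prod => i _; rewrite mulr_ge0 ?(ltW t0) ?sumr_ge0//=.
by rewrite (le_trans (count_grid _ _ _ t0))// opprB addrA subrK.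
Qed.

Definition obox a b : set 'rV[R]_d := [set x | forall i, a 0 i < x 0 i < b 0 i].

Lemma obox_open a b : open (obox a b).
Proof.
rewrite openE => x xab.
have H i : nbhs x [set y : 'rV[R]_d | a 0 i < y 0 i < b 0 i].
  have oI := @interval_open R (BRight (a 0 i)) (BLeft (b 0 i)) isT isT.
  exact: (@coord_continuous R 1 d 0 i x _ (open_nbhs_nbhs (conj oI (xab i)))).
exact: (@filter_forall _ _ _ _ _ H).
Qed.

(** Open boxes are wanted for compactness in [leb_cell]. In dimension 0 every pair of corners has
    volume 1, so the empty box could not be enlarged cheaply; hence [0 < d]. *)
Lemma box_enlarge (Q : box R d) (e : R) : (0 < d)%N -> 0 < e ->
  exists ab : 'rV[R]_d * 'rV[R]_d, box_set Q `<=` obox ab.1 ab.2 /\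
    \prod_i Num.max 0 (ab.2 0 i - ab.1 0 i) <= box_vol Q + e.
Proof.
move=> d0 e0; case: Q => [[a b]|] /=; last first.
  exists (const_mx 0, const_mx 0); split => //=; rewrite add0r.
  by rewrite (bigD1 (Ordinal d0))//= !mxE subrr maxxx mul0r ltW.
have cc := @cvg_prod_shift (fun i => Num.max 0 (b 0 i - a 0 i)).
have /nbhs_ballP[r/= r0 H] : \forall s \near (0 : R),
    \prod_i (Num.max 0 (b 0 i - a 0 i) + s) <= box_vol (Some (a, b)) + e.
  by apply: (cvgr_le _ cc); rewrite ltrDl.
exists (\row_i (a 0 i - r / 4), \row_i (b 0 i + r / 4)); split => [x xab i|].
  by have /andP[? ?] := xab i; rewrite !mxE; apply/andP; split; lra.
apply: le_trans (H (r / 2) _); last first.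
  by rewrite /ball/= sub0r normrN ger0_norm; lra.
apply: ler_prod => i _; rewrite le_max lexx/= !mxE.
have : 0 <= Num.max 0 (b 0 i - a 0 i) by rewrite le_max lexx.
have : b 0 i - a 0 i <= Num.max 0 (b 0 i - a 0 i) by rewrite le_max lexx orbT.
by move=> *; rewrite ge_max; apply/andP; split; lra.
Qed.

Lemma cell_compact (h : R) (k : 'rV[int]_d) : compact (cell h k).
Proof.
rewrite (_ : cell h k = [set x | forall i,
    `[(k 0 i)%:~R * h, (k 0 i + 1)%:~R * h]%classic (x ord0 i)]); last first.
  by apply/seteqP; split => x xk i; have := xk i; rewrite /= in_itv.
exact: (@rV_compact R d (fun i => `[(k 0 i)%:~R * h, (k 0 i + 1)%:~R * h]%classic)
  (fun i => @segment_compact _ _ _)).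
Qed.

(** For the lower bound, the boxes of a cover are enlarged to open ones at a total cost [e].
    Compactness leaves finitely many, and these fall under [cell_cover_le]. *)
Lemma leb_cell (h : R) (k : 'rV[int]_d) : (0 < d)%N -> 0 < h ->
  leb (cell h k) = (h ^+ d)%:E.
Proof.
move=> d0 h0; apply/eqP; rewrite eq_le leb_cell_le ?(ltW h0)//=.
apply: le_ereal_inf_tmp => _ [Q cQ <-].
apply/lee_addgt0Pr => e e0.
have e'0 n : 0 < e / (2 ^ n.+1)%:R by rewrite divr_gt0// ltr0n expn_gt0.
have /choice[ab abP] := fun n => box_enlarge (Q n) d0 (e'0 n).
have := @cell_compact h k; rewrite compact_cover.
move=> /(_ nat setT (fun n => obox (ab n).1 (ab n).2)).
case=> [i _||D _ cD]; first exact: obox_open.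
  by move=> x /cQ[n _ /(proj1 (abP n))]; exists n.
pose N := (\max_(n <- finmap.enum_fset D) n).+1.
have ND n : n \in finmap.enum_fset D -> (n < N)%N.
  by move=> nD; rewrite ltnS; exact: (@leq_bigmax_seq _ _ _ (fun n => n)).
apply: le_trans (epsilon_trick xpredT (fun n => box_vol_ge0 (Q n)) (ltW e0)).
apply: (@le_trans _ _ (\sum_(0 <= n < N) ((box_vol (Q n))%:E + (e / (2 ^ n.+1)%:R)%:E))%E); last first.
  apply: nneseries_lim_ge => n _ _; rewrite adde_ge0 ?box_vol_ge0//.
  by rewrite lee_fin ltW.
rewrite big_mkord; apply: (@le_trans _ _ (\sum_(n < N)
    \prod_i Num.max 0 ((ab n).2 0 i - (ab n).1 0 i))%:E).
  rewrite lee_fin; apply: (@cell_cover_le h k N (fun n => (ab n).1) (fun n => (ab n).2)) => // x.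
  move=> /cD[n /= nD xn]; exists (Ordinal (ND n nD)) => i /=.
  by have /andP[/ltW-> /ltW->] := xn i.
rewrite -sumEFin; apply: lee_sum => n _; rewrite -EFinD lee_fin.
exact: (proj2 (abP n)).
Qed.

End Lebesgue.

(** * Perimeter and test fields *)

Section Under.
Context (R : realType) (d : nat).
Implicit Types (A B : set 'rV[R]_d) (x v : 'rV[R]_d) (i : 'I_d).

Let line_quotient (f : 'rV[R]_d -> R) x v (t : R) :
  (fun h => h^-1 *: (((fun s : R => f (x + s *: v)) \o shift t) (h *: (1 : R)) - f (x + t *: v)))
  = (fun h => h^-1 *: ((f \o shift (x + t *: v)) (h *: v) - f (x + t *: v))).
Proof. by apply/funext => h /=; rewrite addrCA scaler1 scalerDl. Qed.

Lemma derivable_line (f : 'rV[R]_d -> R) x v (t : R) :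
  derivable f (x + t *: v) v -> derivable (fun s : R => f (x + s *: v)) t 1.
Proof.
by rewrite /derivable line_quotient.
Qed.

Lemma derive_line (f : 'rV[R]_d -> R) x v (t : R) :
  'D_1 (fun s : R => f (x + s *: v)) t = 'D_v f (x + t *: v).
Proof. by rewrite /derive line_quotient. Qed.

Lemma integrable_continuous (f : 'rV[R]_d -> R) A (M : R) :
  lmeasurable A -> (leb A < +oo)%E -> continuous f -> (forall x, `|f x| <= M) ->
  (@leb R d).-integrable (A : set (lebesgue_type R d)) (EFin \o f).
Proof.
move=> mA Afin cf fM; apply: measurable_bounded_integrable => //.
- exact: lmeasurable_continuous.
- exists M; split; first exact: num_real.
  by move=> y My x _; apply: le_trans (fM x) (ltW My).
Qed.

Lemma continuous_translate (f : 'rV[R]_d -> R) v :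
  continuous f -> continuous (fun x => f (x + v)).
Proof.
move=> cf x.
have ct : {for x, continuous (fun y : 'rV[R]_d => y + v)}.
  by apply: continuousD; [exact: cvg_id|exact: cst_continuous].
exact: (continuous_comp ct (cf _)).
Qed.

Section Line.
Variables (A : set 'rV[R]_d) (f : 'rV[R]_d -> R) (v : 'rV[R]_d) (M : R).
Hypotheses (mA : lmeasurable A) (Afin : (leb A < +oo)%E).
Hypotheses (cf : continuous f) (fM : forall x, `|f x| <= M).
Hypothesis (df : forall x, derivable f x v).
Hypothesis (dfM : forall x, `|'D_v f x| <= M).

Let g (t : R) : R := \int[@leb R d]_(x in A) (f (x + t *: v)).

(** Differentiation under the integral sign, dominated by the constant [M], which is integrable
    because [A] has finite measure. *)
Lemma is_derive_integral_line (t : R) :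
  is_derive t (1 : R) g (\int[@leb R d]_(x in A) ('D_v f (x + t *: v))).
Proof.
pose F (s : R) (x : lebesgue_type R d) : R := f ((x : 'rV[R]_d) + s *: v).
have tI : `]t - 1, t + 1[%classic t by rewrite /= in_itv/=; apply/andP; split; lra.
have h1 s : `]t - 1, t + 1[%classic s ->
    (@leb R d).-integrable (A : set (lebesgue_type R d)) (EFin \o F s).
  move=> _; apply: (@integrable_continuous (fun x => f (x + s *: v)) A M) => //.
  exact: continuous_translate.
have h2 (s : R) x : `]t - 1, t + 1[%classic s -> A x -> derivable (F ^~ x) s 1.
  by move=> _ _; exact: derivable_line.
have h3 : (@leb R d).-integrable (A : set (lebesgue_type R d)) (EFin \o cst M).
  apply: (@integrable_continuous _ _ `|M|) => //; exact: cst_continuous.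
have M0 : 0 <= M by apply: le_trans (fM 0).
have h4 s x : `]t - 1, t + 1[%classic s -> A x -> `|partial1of2 F s x| <= cst M x.
  by move=> _ _; rewrite partial1of2E derive_line.
have E := @differentiation_under_integral R _ _ _ F A mA t _ _ tI h1 h2 (cst M) (fun=> M0) h3 h4.
have D := @derivable_under_integral R _ _ _ F A mA t _ _ tI h1 h2 (cst M) (fun=> M0) h3 h4.
have D' : derivable g t 1 by exact: D.
have E' : derive1 g t = \int[@leb R d]_(x in (A : set (lebesgue_type R d))) (partial1of2 F ^~ x) t by exact: E.
refine (DeriveDef D' _).
rewrite -derive1E E'; apply: eq_Rintegral => x _.
by rewrite partial1of2E derive_line.
Qed.

End Line.
End Under.

Section C1.
Context (R : realType) (d : nat).
Implicit Types (f g : 'rV[R]_d -> R) (x v : 'rV[R]_d) (i : 'I_d).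

Definition C1c f := [/\ forall x, differentiable f x,
  forall i, continuous ('D_(delta_mx 0 i) f) &
  exists M : R, forall x, f x != 0 -> forall i, `|x 0 i| <= M].

Lemma scaled_delta_deriv f i j k x : differentiable f x ->
  'D_(delta_mx 0 j) (fun y => (f y *: delta_mx 0 i : 'rV[R]_d) 0 k) x =
  'D_(delta_mx 0 j) f x * (k == i)%:R.
Proof.
move=> df; rewrite (_ : (fun y => _) = (fun y => (k == i)%:R * f y)); last first.
  by apply/funext => y; rewrite !mxE eqxx mulrC.
by rewrite deriveMl 1?mulrC//; exact: diff_derivable.
Qed.

Lemma divergence_scaled_delta f i x : differentiable f x ->
  divergence (fun y => f y *: delta_mx 0 i) x = 'D_(delta_mx 0 i) f x.
Proof.
move=> df; rewrite /divergence (bigD1 i)//= scaled_delta_deriv// eqxx mulr1.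
rewrite big1 ?addr0// => j ji.
by rewrite scaled_delta_deriv// (negbTE ji) mulr0.
Qed.

Lemma test_field_scaled_delta f i : C1c f -> (forall x, `|f x| <= 1) ->
  test_field (fun x => f x *: delta_mx 0 i).
Proof.
move=> [df cf [M fM]] f1.
have dF x : differentiable (fun y => f y *: delta_mx 0 i : 'rV[R]_d) x.
  exact: differentiableZl.
split.
- split => //.
  (* In the row convention the only nonzero column of this Jacobian is the [i]-th, made of the
     partial derivatives of [f]. *)
  rewrite (_ : jacobian _ = fun x => \sum_j 'D_(delta_mx 0 j) f x *: delta_mx j i).
    apply: continuous_big => [|j _ x]; first exact: add_continuous.
    by apply: cvgZr_tmp; [exact: (nbhs_filter x)|exact: cf].
  apply/funext => x; apply/matrixP => j k.
  have -> : (\sum_j 'D_(delta_mx 0 j) f x *: delta_mx j i : 'M[R]_d) j k =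
      'D_(delta_mx 0 j) f x * (k == i)%:R.
    rewrite summxE (bigD1 j)//= !mxE eqxx/= big1 ?addr0// => l lj.
    by rewrite !mxE eq_sym (negbTE lj) mulr0.
  have /matrixP/(_ 0 k) := deriveEjacobian (delta_mx 0 j) (dF x).
  rewrite -rowE [RHS]mxE => <-.
  by rewrite derive_mx ?[LHS]mxE ?scaled_delta_deriv//; exact: diff_derivable.
- have cK := @rV_compact R d (fun=> `[- M, M]%classic) (fun=> @segment_compact _ _ _).
  apply: (subclosed_compact (@closed_closure _ _) cK).
  have /closure_id -> := compact_closed (@norm_hausdorff _ _) cK.
  apply: closureS => x /= fx j; rewrite in_itv/= -ler_norml.
  by apply: fM; apply: contra_neq fx => ->; rewrite scale0r.
- move=> x; rewrite /euclidean_norm (bigD1 i)//= big1; last first.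
    by move=> j ji; rewrite !mxE (negbTE ji) andbF mulr0 expr0n.
  by rewrite !mxE !eqxx mulr1 addr0 sqrtr_sqr.
Qed.

End C1.

Section Perimeter.
Context (R : realType) (d : nat).
Implicit Types (f g : 'rV[R]_d -> R) (x v : 'rV[R]_d) (i : 'I_d) (A B : set 'rV[R]_d).

Lemma continuous_supp_bounded f (M : R) : continuous f ->
  (forall x, f x != 0 -> forall i, `|x 0 i| <= M) ->
  exists N : R, forall x, `|f x| <= N.
Proof.
move=> cf fM.
have cK := @rV_compact R d (fun=> `[- M, M]%classic) (fun=> @segment_compact _ _ _).
have [N [_ NP]] := compact_bounded (continuous_compact (continuous_subspaceT cf) cK).
exists (Num.max 0 (N + 1)) => x.
have [->|fx] := eqVneq (f x) 0; first by rewrite normr0 le_max lexx.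
rewrite le_max (NP (N + 1)) ?orbT ?ltrDl//; exists x => //= i.
by rewrite in_itv/= -ler_norml; exact: fM.
Qed.

Lemma C1c_continuous f : C1c f -> continuous f.
Proof. by move=> [df _ _] x; exact: differentiable_continuous. Qed.

Lemma C1c_derivable f x v : C1c f -> derivable f x v.
Proof. by move=> [df _ _]; exact: diff_derivable. Qed.

(** Points with some coordinate beyond [M] form an open set on which [f] vanishes, so [f] is locally
    constant there. *)
Lemma derive_supp f v (M : R) : (forall x, f x != 0 -> forall i, `|x 0 i| <= M) ->
  forall x, 'D_v f x != 0 -> forall i, `|x 0 i| <= M.
Proof.
move=> fM x fx i; rewrite leNgt; apply/negP => Mx; move/eqP: fx; apply.
rewrite -(derive_cst (0 : R) x v); apply: near_eq_derive.
have : nbhs x [set y : 'rV[R]_d | M < `|y 0 i|].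
  have cn : {for x, continuous (fun y : 'rV[R]_d => `|y 0 i|)}.
    apply: (continuous_comp (g := fun z : R => `|z|)); first exact: coord_continuous.
    exact: norm_continuous.
  exact: (@cvgr_gt _ _ _ (nbhs_filter x) _ _ cn _ Mx).
apply: filterS => y /= My; apply/eqP/negPn/negP => /fM/(_ i).
by rewrite leNgt My.
Qed.

Lemma C1c_bound f i : C1c f ->
  exists N : R, forall x, `|f x| <= N /\ `|'D_(delta_mx 0 i) f x| <= N.
Proof.
move=> Cf; have [df cdf [M fM]] := Cf.
have [N1 N1P] := continuous_supp_bounded (C1c_continuous Cf) fM.
have [N2 N2P] := continuous_supp_bounded (cdf i) (derive_supp fM).
exists (Num.max N1 N2) => x.
by rewrite !le_max N1P N2P orbT.
Qed.

Lemma test_field_coord (v : 'rV[R]_d -> 'rV[R]_d) k : test_field v ->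
  C1c (fun y => v y 0 k) /\ forall x, `|v x 0 k| <= 1.
Proof.
move=> [[dv cJ] cs v1].
have dvk x : differentiable (fun y => v y 0 k) x.
  exact: (differentiable_comp (dv x) (differentiable_coord _ _ _)).
split; last first.
  move=> x; apply: le_trans (v1 x); rewrite -sqrtr_sqr ler_sqrt.
    by rewrite (bigD1 k)//= lerDl sumr_ge0// => i _; rewrite sqr_ge0.
  by rewrite sumr_ge0// => i _; rewrite sqr_ge0.
split => // [i|].
- have -> : 'D_(delta_mx 0 i) (fun y => v y 0 k) = (fun x => jacobian v x i k).
    apply/funext => x; have /matrixP/(_ 0 k) := deriveEjacobian (delta_mx 0 i) (dv x).
    rewrite -rowE [RHS]mxE => <-.
    by rewrite derive_mx ?[RHS]mxE//; exact: diff_derivable.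
  move=> x; exact: (continuous_comp (cJ x) (@coord_continuous R d d i k _)).
- have [N [_ NP]] := compact_bounded cs.
  exists (N + 1) => x fx i; apply: le_trans (NP (N + 1) _ x _); last 2 first.
  + by rewrite ltrDl.
  + by apply: subset_closure => /=; apply: contra_neq fx => ->; rewrite mxE.
  by rewrite [leRHS]/Num.Def.normr/= mx_normrE; apply: le_trans; last exact: (le_bigmax _ _ (0, i)).
Qed.

Lemma per_integralE (u : 'rV[R]_d -> R) A :
  lmeasurable A -> (@leb R d).-integrable (A : set (lebesgue_type R d)) (EFin \o u) ->
  (\int[@leb R d]_x (\1_A x * u x)%:E)%E = (\int[@leb R d]_(x in A) u x)%:E.
Proof.
move=> mA iu.
transitivity (\int[@leb R d]_(x in (A : set (lebesgue_type R d))) (u x)%:E)%E.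
  rewrite [RHS]integral_mkcond; apply: eq_integral => x _.
  by rewrite patchE indicE; case: ifPn => _; rewrite ?mul1r ?mul0r.
by rewrite /Rintegral fineK//; exact: integrable_fin_num.
Qed.

Lemma C1c_integrable f A i : lmeasurable A -> (leb A < +oo)%E -> C1c f ->
  (@leb R d).-integrable (A : set (lebesgue_type R d)) (EFin \o f) /\
  (@leb R d).-integrable (A : set (lebesgue_type R d)) (EFin \o 'D_(delta_mx 0 i) f).
Proof.
move=> mA Af Cf; have [N NP] := C1c_bound i Cf; have [_ cD _] := Cf.
split; (apply: (integrable_continuous mA Af) => [|x]; last exact: (NP x).1) ||
  (apply: (integrable_continuous mA Af) => [|x]; last exact: (NP x).2).
- exact: C1c_continuous.
- exact: cD.
Qed.

Lemma perimeter_ge f i A : lmeasurable A -> (leb A < +oo)%E ->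
  C1c f -> (forall x, `|f x| <= 1) ->
  ((\int[@leb R d]_(x in A) 'D_(delta_mx 0 i) f x)%:E <= perimeter A)%E.
Proof.
move=> mA Af Cf f1; apply: ereal_sup_ubound.
exists (fun x => f x *: delta_mx 0 i); first exact: test_field_scaled_delta.
rewrite -per_integralE//; last by have [] := C1c_integrable i mA Af Cf.
by apply: eq_integral => x _; rewrite divergence_scaled_delta//; case: Cf.
Qed.

Lemma C1cN f : C1c f -> C1c (fun x => - f x).
Proof.
move=> Cf; have [df cf [M fM]] := Cf; split.
- by move=> x; exact: differentiableN.
- move=> i; rewrite (_ : 'D_ _ _ = fun x => - 'D_(delta_mx 0 i) f x).
    move=> x; exact: (@cvgN _ _ _ (nbhs x) (nbhs_filter x) _ _ (cf i x)).
  by apply/funext => x; rewrite deriveN//; exact: C1c_derivable.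
- by exists M => x fx; apply: fM; rewrite oppr_eq0 in fx.
Qed.

Lemma perimeter_ge0 A : lmeasurable A -> (0 <= perimeter A)%E.
Proof.
move=> mA; apply: ereal_sup_ubound; exists (fun=> 0); last first.
  under eq_integral do rewrite /divergence.
  rewrite -(integral0 (@leb R d) setT); apply: eq_integral => x _.
  rewrite /divergence big1 ?mulr0// => i _.
  by under eq_fun do rewrite mxE; rewrite derive_cst.
split.
- split; first by move=> x; exact: differentiable_cst.
  rewrite (_ : jacobian _ = cst 0); first exact: cst_continuous.
  by apply/funext => x; apply/matrixP => i j; rewrite /jacobian diff_cst !mxE.
- rewrite /compactly_supported (_ : [set _ | _] = set0) ?closure0; first exact: compact0.
  by apply/seteqP; split => x //=; rewrite eqxx.
- move=> x; rewrite /euclidean_norm big1 ?sqrtr0// => i _.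
  by rewrite mxE expr0n.
Qed.

Lemma per_ge f i A : lmeasurable A -> (leb A < +oo)%E -> (perimeter A < +oo)%E ->
  C1c f -> (forall x, `|f x| <= 1) ->
  `|\int[@leb R d]_(x in A) 'D_(delta_mx 0 i) f x| <= per A.
Proof.
move=> mA Af Ap Cf f1.
have pE : perimeter A = (per A)%:E.
  by rewrite /per fineK// ge0_fin_numE// perimeter_ge0.
rewrite ler_norml; apply/andP; split; last first.
  by rewrite -lee_fin -pE; exact: perimeter_ge.
rewrite lerNl -lee_fin -pE.
have := @perimeter_ge (fun x => - f x) i A mA Af (C1cN Cf) _.
move=> H; apply: le_trans (H _); last by move=> x; rewrite normrN.
rewrite lee_fin le_eqVlt; apply/orP; left; apply/eqP.
rewrite -mulN1r -RintegralZl//; last by have [] := C1c_integrable i mA Af Cf.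
apply: eq_Rintegral => x _.
by rewrite mulN1r deriveN//; exact: C1c_derivable.
Qed.

End Perimeter.

Section Shift.
Context (R : realType) (d : nat).
Implicit Types (f g : 'rV[R]_d -> R) (x z : 'rV[R]_d) (i : 'I_d) (A B : set 'rV[R]_d).

(** By [leb_shift], the pushforward of Lebesgue measure under a translation is Lebesgue measure
    again. *)
Lemma Rintegral_shift f A z : lmeasurable A -> (leb A < +oo)%E -> C1c f ->
  \int[@leb R d]_(x in A) f (x + z) = \int[@leb R d]_(x in [set y | A (y - z)]) f x.
Proof.
move=> mA Af Cf.
pose phi (x : lebesgue_type R d) : lebesgue_type R d := (x : 'rV[R]_d) + z.
pose D : set (lebesgue_type R d) := [set y : 'rV[R]_d | A (y - z)].
have mphi : measurable_fun [set: lebesgue_type R d] phi.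
  by move=> _ Y mY; rewrite setTI; exact: lmeasurable_shift.
have mD : measurable D by exact: lmeasurable_shift.
have pE : phi @^-1` D = A.
  by apply/seteqP; split => x; rewrite /D /phi /= addrK.
pose fl : lebesgue_type R d -> R := f.
have mf0 : measurable_fun [set: lebesgue_type R d] fl.
  by apply: lmeasurable_continuous; [exact: measurableT|exact: C1c_continuous].
have mf := (measurable_EFinP _ _).2 mf0.
have fi : (@leb R d).-integrable (phi @^-1` D) ((EFin \o fl) \o phi).
  rewrite pE.
  have [N NP] : exists N : R, forall x, `|f x| <= N.
    case: Cf => df _ [M fM]; apply: (continuous_supp_bounded _ fM).
    by move=> x; exact: differentiable_continuous.
  apply: (@integrable_continuous _ _ (fun x => f (x + z)) A N) => //.
  exact: (continuous_translate (C1c_continuous Cf)).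
have E := @integral_pushforward _ _ _ _ _ phi mphi (@leb R d) D (EFin \o fl) mf fi mD.
rewrite pE in E.
rewrite /Rintegral; congr fine.
transitivity (\int[pushforward (@leb R d) phi]_(y in D) (EFin \o fl) y)%E.
  by rewrite E.
by apply: eq_measure_integral => Y mY _; exact: leb_shift.
Qed.

Lemma Rintegral_setD_le f A B : lmeasurable A -> lmeasurable B ->
  (leb A < +oo)%E -> (leb B < +oo)%E -> C1c f -> (forall x, `|f x| <= 1) ->
  \int[@leb R d]_(x in A) f x - \int[@leb R d]_(x in B) f x <=
  fine (leb (A `\` B)) + fine (leb (B `\` A)).
Proof.
move=> mA mB Af Bf Cf f1.
have If C : lmeasurable C -> (leb C < +oo)%E ->
    (@leb R d).-integrable (C : set (lebesgue_type R d)) (EFin \o f).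
  by move=> mC Cfi; apply: (integrable_continuous mC Cfi (C1c_continuous Cf) f1).
have split2 C D : lmeasurable C -> lmeasurable D -> (leb C < +oo)%E ->
    \int[@leb R d]_(x in C) f x = \int[@leb R d]_(x in C `&` D) f x +
    \int[@leb R d]_(x in C `\` D) f x.
  move=> mC mD Cfi; rewrite -[in LHS](setUIDK C D) Rintegral_setU//.
  - exact: lmeasurableI.
  - exact: lmeasurableD.
  - by rewrite setUIDK; exact: If.
  - by apply/disj_setPS => x [[_ Dx] [_]].
have bnd C : lmeasurable C -> (leb C < +oo)%E ->
    `|\int[@leb R d]_(x in C) f x| <= fine (leb C).
  move=> mC Cfi; apply: le_trans (le_normr_Rintegral _ (If _ mC Cfi)) _ => //.
  rewrite -[leRHS]mul1r -Rintegral_cst//; apply: le_Rintegral => //.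
  + exact: integrable_norm (If _ mC Cfi).
  + apply: (@integrable_continuous _ _ (cst 1) C 1) => //; first exact: cst_continuous.
    by move=> x; rewrite normr1.
have fD (C D : set 'rV[R]_d) : lmeasurable C -> lmeasurable D -> (leb C < +oo)%E -> (leb (C `\` D) < +oo)%E.
  by move=> mC mD; apply: le_lt_trans; apply: le_leb => x [].
rewrite (split2 A B)// (split2 B A)// (setIC B A) opprD addrACA subrr add0r.
apply: lerD; apply: le_trans (ler_norm _) _; rewrite ?normrN; apply: bnd.
- exact: lmeasurableD.
- exact: fD.
- exact: lmeasurableD.
- exact: fD.
Qed.

(** Each component of a test field is itself bounded by 1, so the flux can be estimated direction by
    direction. *)
Lemma perimeter_le A (c : 'I_d -> R) : lmeasurable A -> (leb A < +oo)%E ->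
  (forall f i, C1c f -> (forall x, `|f x| <= 1) ->
    \int[@leb R d]_(x in A) 'D_(delta_mx 0 i) f x <= c i) ->
  (perimeter A <= (\sum_i c i)%:E)%E.
Proof.
move=> mA Af H; apply: ge_ereal_sup => _ [v tv <-].
have Cv k := (test_field_coord k tv).1; have v1 k := (test_field_coord k tv).2.
pose Dv k : 'rV[R]_d -> R := 'D_(delta_mx 0 k) (fun y => v y 0 k).
have iD k : (@leb R d).-integrable (A : set (lebesgue_type R d))
    (EFin \o Dv k).
  by have [] := C1c_integrable k mA Af (Cv k).
rewrite per_integralE//; last first.
  rewrite (_ : EFin \o _ =
      fun x => (\sum_k (EFin \o Dv k) x)%E).
    exact: integrable_sum.
  by apply/funext => x /=; rewrite sumEFin.
rewrite lee_fin; apply: (@le_trans _ _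
    (\sum_k \int[@leb R d]_(x in A) 'D_(delta_mx 0 k) (fun y => v y 0 k) x)); last first.
  by apply: ler_sum => k _; exact: H.
rewrite /divergence; elim: (index_enum _) => [|k s IH].
  rewrite big_nil; under eq_Rintegral do rewrite big_nil.
  by rewrite Rintegral_cst// mul0r.
rewrite big_cons; under eq_Rintegral do rewrite big_cons.
rewrite RintegralD//; [by rewrite lerD2l|exact: iD|].
rewrite (_ : EFin \o _ =
    fun x => (\sum_(k <- s) (EFin \o Dv k) x)%E).
  exact: integrable_sum.
by apply/funext => x /=; rewrite sumEFin.
Qed.

Lemma derive_translate f v z x : 'D_v (fun y => f (y + z)) x = 'D_v f (x + z).
Proof.
rewrite /derive (_ : (fun h => h^-1 *: (((fun y => f (y + z)) \o shift x) (h *: v) - f (x + z)))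
  = (fun h => h^-1 *: ((f \o shift (x + z)) (h *: v) - f (x + z))))//.
by apply/funext => h /=; rewrite addrA.
Qed.

Lemma C1c_translate f z : C1c f -> C1c (fun x => f (x + z)).
Proof.
move=> [df cf [M fM]]; split.
- move=> x; apply: (@differentiable_comp _ _ _ _ (fun y : 'rV[R]_d => y + z) f); last exact: df.
  have H1 : differentiable (id : 'rV[R]_d -> 'rV[R]_d) x by [].
  have D := differentiableD H1 (differentiable_cst z x).
  refine D.
- move=> i; rewrite (_ : 'D_ _ _ = fun x => 'D_(delta_mx 0 i) f (x + z)).
    exact: (continuous_translate (cf i)).
  by apply/funext => x; exact: derive_translate.
- exists (M + `|z|) => x /fM xM i; have {xM} := xM i; rewrite mxE => xM.
  have zi : `|z 0 i| <= `|z|.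
    by rewrite [leRHS]/Num.Def.normr/= mx_normrE; apply: le_trans; last exact: (le_bigmax _ _ (0, i)).
  rewrite -[x 0 i](addrK (z 0 i)) (le_trans (ler_normB _ _))//.
  exact: lerD.
Qed.

Lemma is_derive_integral_C1c f i A t : lmeasurable A -> (leb A < +oo)%E -> C1c f ->
  is_derive t (1 : R) (fun s => \int[@leb R d]_(x in A) f (x + s *: delta_mx 0 i))
    (\int[@leb R d]_(x in A) 'D_(delta_mx 0 i) f (x + t *: delta_mx 0 i)).
Proof.
move=> mA Af Cf.
have [N NP] := C1c_bound i Cf; have [_ cD _] := Cf.
exact: (is_derive_integral_line mA Af (C1c_continuous Cf) (fun x => (NP x).1)
  (fun x => @C1c_derivable _ _ f x (delta_mx 0 i) Cf) (fun x => (NP x).2) t).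
Qed.

(* Mean value theorem: the derivative in [h] is the flux of a translate of [f]. *)
Lemma per_diff_le f i A (h : R) : lmeasurable A -> (leb A < +oo)%E ->
  (perimeter A < +oo)%E -> C1c f -> (forall x, `|f x| <= 1) -> 0 <= h ->
  \int[@leb R d]_(x in A) f (x + h *: delta_mx 0 i) - \int[@leb R d]_(x in A) f x
  <= h * per A.
Proof.
move=> mA Af Ap Cf f1 h0.
have D t := @is_derive_integral_C1c f i A t mA Af Cf.
have [|c _] := MVT_segment h0 (fun t _ => D t).
  by apply: derivable_within_continuous => t _; have [] := D t.
rewrite scale0r subr0; under [X in _ - X = _]eq_Rintegral do rewrite addr0.
move=> ->; rewrite mulrC ler_wpM2l// (le_trans (ler_norm _))//.
under eq_Rintegral do rewrite -derive_translate.
apply: per_ge => //; first exact: C1c_translate.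
Qed.

(* The integral of the partial derivative is the derivative at [0] of the
   integral of [f] over the translates of [A]. *)
Lemma derive_flux_le f i A (c1 c2 e : R) : lmeasurable A -> (leb A < +oo)%E ->
  C1c f -> (forall x, `|f x| <= 1) -> 0 < e ->
  (forall t, 0 < t < e ->
    (leb (A `\` [set x : 'rV[R]_d | A (x - t *: delta_mx 0%R i)%R]) <= (t * c1)%:E)%E /\
    (leb ([set x : 'rV[R]_d | A (x - t *: delta_mx 0%R i)%R] `\` A) <= (t * c2)%:E)%E) ->
  \int[@leb R d]_(x in A) 'D_(delta_mx 0 i) f x <= c1 + c2.
Proof.
move=> mA Af Cf f1 e0 H.
pose g s := \int[@leb R d]_(x in A) f (x + s *: delta_mx 0 i).
have Dg : is_derive (0 : R) (1 : R) g (\int[@leb R d]_(x in A) 'D_(delta_mx 0 i) f x).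
  apply: is_derive_eq; first exact: (@is_derive_integral_C1c f i A 0 mA Af Cf).
  by apply: eq_Rintegral => x _; rewrite scale0r addr0.
have [dg <-] := Dg.
(* The steps [e / (n + 2)] lie strictly between 0 and [e], where the hypothesis [H] applies. *)
have u0 n : 0 < e / n.+2%:R by rewrite divr_gt0.
have gq : (e / n.+2%:R)^-1 * (g (e / n.+2%:R) - g 0) @[n --> \oo] --> 'D_1 g 0.
  have cu : e / n.+2%:R @[n --> \oo] --> (0 : R).
    rewrite -(mulr0 e); apply: cvgM; first exact: cvg_cst.
    by have := @cvg_harmonic R; rewrite -(cvg_shiftS (fun n => n.+1%:R^-1 : R)).
  have /cvgr_dnbhsP/(_ _ (conj (fun n => lt0r_neq0 (u0 n)) cu)) : cvg _ := dg.
  by under eq_fun do rewrite /= addr0 scaler1.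
apply: (cvgr_to_le gq); apply: nearW => n.
have ue : 0 < e / n.+2%:R < e.
  by rewrite u0 ltr_pdivrMr// ltr_pMr// ltr1n.
have [] := H _ ue; have := u0 n; move: (e / n.+2%:R) => t t0 H1 H2.
rewrite mulrC ler_pdivrMr// mulrC /g scale0r.
under [X in _ - X]eq_Rintegral do rewrite addr0.
rewrite Rintegral_shift// mulrDr [leRHS]addrC.
set A' := [set y | A (y - t *: delta_mx 0 i)] in H1 H2 *.
have mA' : lmeasurable A' by exact: lmeasurable_shift.
have A'f : (leb A' < +oo)%E by rewrite leb_shift.
apply: (le_trans (Rintegral_setD_le mA' mA A'f Af Cf f1)).
rewrite lerD// -lee_fin fineK//; rewrite ge0_fin_numE ?leb_ge0//.
- by apply: le_lt_trans A'f; apply: le_leb => x [].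
- by apply: le_lt_trans Af; apply: le_leb => x [].
Qed.

End Shift.

(** * Smoothed indicators of cells *)

Section Bump.
Context (R : realType).

(* A [C^1] substitute for the positive part. *)
Definition sqp (x : R) : R := Num.max 0 x ^+ 2.

(** A quadratic remainder, uniform in [x], gives the derivative without treating the kink at 0
    apart. *)
Lemma sqp_taylor (x h : R) :
  `|sqp (h + x) - sqp x - h * (2 * Num.max 0 x)| <= h ^+ 2.
Proof.
rewrite /sqp ler_norml /Num.max; case: ltP => ?; case: ltP => ?;
  apply/andP; split; nra.
Qed.

Lemma is_derive_sqp (x : R) : is_derive x (1 : R) sqp (2 * Num.max 0 x).
Proof.
suff H : h^-1 *: ((sqp \o shift x) (h *: (1 : R)) - sqp x) @[h --> (0 : R)^'] --> 2 * Num.max 0 x.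
  by apply: DeriveDef; [apply/cvg_ex; exists (2 * Num.max 0 x)|exact: cvg_lim].
apply/cvgrPdist_le => e e0; near=> h.
have h0 : h != 0 by near: h; exact: nbhs_dnbhs_neq.
rewrite /= scaler1 -normrN opprB.
have -> : h^-1 *: (sqp (h + x) - sqp x) - 2 * Num.max 0 x =
    h^-1 * (sqp (h + x) - sqp x - h * (2 * Num.max 0 x)).
  by rewrite mulrBr mulKf.
rewrite normrM normfV ler_pdivrMl ?normr_gt0// (le_trans (sqp_taylor _ _))//.
rewrite -(real_normK (num_real h)) expr2 ler_wpM2l//.
by near: h; exact: dnbhs0_le.
Unshelve. all: by end_near. Qed.

Lemma continuous_maxr0 : continuous (fun x : R => Num.max 0 x).
Proof. by move=> x; apply: continuous_max; [exact: cst_continuous|exact: cvg_id]. Qed.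

End Bump.

Section C1closure.
Context (R : realType) (d : nat).
Implicit Types (f g : 'rV[R]_d -> R) (x v : 'rV[R]_d) (i j : 'I_d).

Definition C1 f := (forall x, differentiable f x) /\
  forall i, continuous ('D_(delta_mx 0 i) f).

Lemma C1_derivable f x v : C1 f -> derivable f x v.
Proof. by move=> [df _]; exact: diff_derivable. Qed.

Lemma C1_continuous f : C1 f -> continuous f.
Proof. by move=> [df _] x; exact: differentiable_continuous. Qed.

Lemma C1D f g : C1 f -> C1 g -> C1 (fun x => f x + g x).
Proof.
move=> Cf Cg; split => [x|i].
  by apply: differentiableD; [exact: Cf.1|exact: Cg.1].
have -> : 'D_(delta_mx 0 i) (fun x => f x + g x) =
    fun x => 'D_(delta_mx 0 i) f x + 'D_(delta_mx 0 i) g x.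
  by apply/funext => x; apply: deriveD; exact: C1_derivable.
by move=> x; exact: (continuousD (Cf.2 i x) (Cg.2 i x)).
Qed.

Lemma C1M f g : C1 f -> C1 g -> C1 (fun x => f x * g x).
Proof.
move=> Cf Cg; split => [x|i].
  by apply: differentiableM; [exact: Cf.1|exact: Cg.1].
have -> : 'D_(delta_mx 0 i) (fun x => f x * g x) =
    fun x => f x * 'D_(delta_mx 0 i) g x + g x * 'D_(delta_mx 0 i) f x.
  by apply/funext => x; apply: deriveM; exact: C1_derivable.
have cf : continuous f by exact: C1_continuous.
have cg : continuous g by exact: C1_continuous.
move=> x; exact: (continuousD (continuousM (cf x) (Cg.2 i x))
  (continuousM (cg x) (Cf.2 i x))).
Qed.

Lemma C1_cst (c : R) : C1 (fun=> c).
Proof.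
split=> [x|i]; first exact: differentiable_cst.
have -> : 'D_(delta_mx 0 i) (fun=> c) = cst 0 :> ('rV[R]_d -> R).
  by apply/funext => x; exact: derive_cst.
exact: cst_continuous.
Qed.

Lemma C1_sum (I : Type) (s : seq I) (F : I -> 'rV[R]_d -> R) :
  (forall t, C1 (F t)) -> C1 (fun x => \sum_(t <- s) F t x).
Proof.
move=> CF; elim: s => [|t s IH].
  by under eq_fun do rewrite big_nil; exact: C1_cst.
by under eq_fun do rewrite big_cons; exact: C1D.
Qed.

Lemma C1_prod (I : Type) (s : seq I) (F : I -> 'rV[R]_d -> R) :
  (forall t, C1 (F t)) -> C1 (fun x => \prod_(t <- s) F t x).
Proof.
move=> CF; elim: s => [|t s IH].
  by under eq_fun do rewrite big_nil; exact: C1_cst.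
by under eq_fun do rewrite big_cons; exact: C1M.
Qed.

Lemma C1_coord i : C1 (fun x => x 0 i).
Proof.
split=> [x|j]; first exact: differentiable_coord.
have -> : 'D_(delta_mx 0 j) (fun x : 'rV[R]_d => x 0 i) = cst ((i == j)%:R : R).
  apply/funext => x; apply: cvg_lim => //; apply: cvg_near_cst; near=> h => /=.
  rewrite !mxE addrK eqxx /= /GRing.scale /= mulKf//.
  by near: h; exact: nbhs_dnbhs_neq.
exact: cst_continuous.
Unshelve. all: by end_near. Qed.

Lemma C1_comp (g dg : R -> R) f : C1 f -> (forall y, is_derive y (1 : R) g (dg y)) ->
  continuous dg -> C1 (fun x => g (f x)).
Proof.
move=> Cf Dg cdg.
have dfg y : differentiable g y by apply/derivable1_diffP; have [] := Dg y.
split=> [x|i].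
  by apply: (@differentiable_comp _ _ _ _ f g); [exact: Cf.1|exact: dfg].
have -> : 'D_(delta_mx 0 i) (fun x => g (f x)) =
    fun x => dg (f x) * 'D_(delta_mx 0 i) f x.
  apply/funext => x; rewrite deriveE; last first.
    by apply: (@differentiable_comp _ _ _ _ f g); [exact: Cf.1|exact: dfg].
  rewrite (@diff_comp _ _ _ _ f g) /=; [|exact: Cf.1|exact: dfg].
  have [dgx <-] := Dg (f x).
  rewrite deriv1E// derive1E [in RHS](deriveE _ (Cf.1 x)) mulrC.
  by [].
have cf : continuous f by exact: C1_continuous.
move=> x; exact: (continuousM (continuous_comp (cf x) (cdg _)) (Cf.2 i x)).
Qed.

End C1closure.

Section CellBump.
Context (R : realType) (d : nat).
Implicit Types (f g : 'rV[R]_d -> R) (x v : 'rV[R]_d) (i j : 'I_d) (k : 'rV[int]_d) (h : R).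
Implicit Types (A B : set 'rV[R]_d).

(** Open cells with distinct keys are disjoint, whereas closed ones share faces; the difference is
    negligible by [leb_cell_ocell]. *)
Definition ocell h k : set 'rV[R]_d :=
  [set x | forall i, (k 0 i)%:~R * h < x 0 i < (k 0 i + 1)%:~R * h].

Lemma ocell_obox h k : ocell h k =
  obox (\row_i ((k 0 i)%:~R * h)) (\row_i ((k 0 i + 1)%:~R * h)).
Proof. by apply/seteqP; split => x kx i; have := kx i; rewrite !mxE. Qed.

Lemma lmeasurable_ocell h k : lmeasurable (ocell h k).
Proof. by apply: lmeasurable_open; rewrite ocell_obox; exact: obox_open. Qed.

Lemma ocell_sub h k : ocell h k `<=` cell h k.
Proof. by move=> x kx i; have /andP[/ltW-> /ltW->] := kx i. Qed.

Lemma cell_le h k1 k2 x i : 0 < h -> ocell h k1 x -> cell h k2 x -> k1 0 i <= k2 0 i.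
Proof.
move=> h0 /(_ i)/andP[+ _] /(_ i)/andP[_ ].
move=> /[swap] /lt_le_trans/[apply].
by rewrite ltr_pM2r// ltr_int; lia.
Qed.

Lemma cell_ge h k1 k2 x i : 0 < h -> ocell h k1 x -> cell h k2 x -> k2 0 i <= k1 0 i.
Proof.
move=> h0 /(_ i)/andP[_ +] /(_ i)/andP[+ _ ].
move=> /le_lt_trans/[apply].
by rewrite ltr_pM2r// ltr_int; lia.
Qed.

Lemma ocell_cell_inj h k1 k2 x : 0 < h -> ocell h k1 x -> cell h k2 x -> k1 = k2.
Proof.
move=> h0 x1 x2; apply/rowP => i; apply/eqP; rewrite eq_le.
by rewrite (cell_le i h0 x1 x2) (cell_ge i h0 x1 x2).
Qed.

Lemma leb_bigcup0 (T : eqType) (s : seq T) (F : T -> set 'rV[R]_d) :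
  (forall t, t \in s -> leb (F t) = 0%E) -> leb [set x | exists2 t, t \in s & F t x] = 0%E.
Proof.
move=> F0; apply/eqP; rewrite eq_le leb_ge0 andbT.
elim: s F0 => [|t s IH] F0.
  rewrite (_ : [set _ | _] = set0) ?lebesgue_outer0//; last by apply/seteqP; split => x // [].
  by rewrite measure0.
apply: (@le_trans _ _ (leb (F t `|` [set x | exists2 t, t \in s & F t x]))%E).
  apply: le_leb => x [u]; rewrite inE => /predU1P[->|us] Fu; [by left|].
  by right; exists u.
apply: (le_trans (lebU_le _ _)); rewrite F0 ?mem_head// add0e.
by apply: IH => u us; apply: F0; rewrite inE us orbT.
Qed.

Lemma leb_sub0 A B : A `<=` B -> leb B = 0%E -> leb A = 0%E.
Proof.
by move=> AB B0; apply/eqP; rewrite eq_le leb_ge0 andbT -B0; exact: le_leb.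
Qed.

Lemma leb_cell_ocell h k : leb (cell h k `\` ocell h k) = 0%E.
Proof.
(* [F (i, b)] is a face orthogonal to direction [i]: the upper one if [b] holds, the lower one
   otherwise. As a box it is degenerate. *)
pose F (p : 'I_d * bool) := cbox
  (\row_j (if (j == p.1) && p.2 then (k 0 j + 1)%:~R * h else (k 0 j)%:~R * h))
  (\row_j (if (j == p.1) && ~~ p.2 then (k 0 j)%:~R * h else (k 0 j + 1)%:~R * h)).
apply: (@leb_sub0 _ [set x | exists2 p, p \in index_enum ('I_d * bool)%type & F p x]).
  move=> x [kx]; rewrite /ocell /= => /existsNP[i /negP].
  have /andP[kx1 kx2] := kx i.
  rewrite negb_and -!leNgt => /orP[xk|xk].
  - exists (i, false); rewrite ?mem_index_enum// => j; have := kx j; rewrite !mxE /= andbF andbT.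
    by case: eqP => [->|//] /andP[-> _].
  - exists (i, true); rewrite ?mem_index_enum// => j; have := kx j; rewrite !mxE /= andbF andbT.
    by case: eqP => [->|//] /andP[_ ->]; rewrite andbT.
apply: leb_bigcup0 => -[i b] _; apply: (@leb_cbox0 _ _ _ _ i).
by rewrite !mxE eqxx; case: b.
Qed.

Lemma leb_cell_inter0 h k1 k2 : 0 < h -> k1 != k2 -> leb (cell h k1 `&` cell h k2) = 0%E.
Proof.
move=> h0 k12; apply: leb_sub0 (leb_cell_ocell h k1) => x [x1 x2]; split => // o1.
by move/eqP: k12; apply; exact: (ocell_cell_inj h0 o1 x2).
Qed.

Lemma leb_setI_cell A h k : leb (A `&` cell h k) = leb (A `&` ocell h k).
Proof.
apply/eqP; rewrite eq_le; apply/andP; split; last first.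
  by apply: le_leb => x [Ax /ocell_sub].
rewrite -[leRHS]adde0 -(leb_cell_ocell h k); apply: le_trans (lebU_le _ _).
apply: le_leb => x [Ax kx]; have [kx'|kx'] := pselect (ocell h k x); [by left|by right].
Qed.

(** On a side of length [h] the product of the distances to the endpoints is at most [h^2 / 4],
    whence the normalization. [sqp] makes the factor vanish in a [C^1] way beyond the endpoints. *)
Definition cell_bump h k x : R :=
  \prod_j sqp (4 / h ^+ 2 * ((x 0 j - (k 0 j)%:~R * h) * ((k 0 j + 1)%:~R * h - x 0 j))).

Lemma cell_bump_C1 h k : C1 (cell_bump h k).
Proof.
apply: C1_prod => j.
apply: (@C1_comp _ _ (@sqp R) (fun y => 2 * Num.max 0 y)).
- have Cx := @C1_coord R d j; have Cc := @C1_cst R d.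
  apply: C1M; first exact: Cc.
  apply: C1M; first by apply: C1D; [exact: Cx|exact: Cc].
  apply: C1D; first exact: Cc.
  have -> : (fun x : 'rV[R]_d => - x 0 j) = (fun x => -1 * x 0 j).
    by apply/funext => x; rewrite mulN1r.
  by apply: C1M; [exact: Cc|exact: Cx].
- exact: is_derive_sqp.
- have c2 : continuous (fun _ : R => 2 : R) by exact: cst_continuous.
  by move=> y; exact: (continuousM (c2 y) (@continuous_maxr0 R y)).
Qed.

(** Translating by one mesh only changes the key; this turns the bound of [per_diff_le] into one on
    differences between neighbouring cells. *)
Lemma cell_bump_shift h k x i :
  cell_bump h k (x + h *: delta_mx 0 i) = cell_bump h (k - delta_mx 0 i) x.
Proof.
apply: eq_bigr => j _; rewrite !mxE eqxx/=; congr sqp; congr (_ * _).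
have E : (k 0 j - (j == i)%:R)%:~R = (k 0 j)%:~R - (j == i)%:R :> R.
  by rewrite rmorphB/=; case: (j == i).
rewrite [(_ - _ + 1)%:~R]intrD E intrD.
by case: (j == i); rewrite /=; ring.
Qed.

Lemma sqp_range (h a b y : R) : 0 < h -> b = a + h ->
  0 <= sqp (4 / h ^+ 2 * ((y - a) * (b - y))) <= 1.
Proof.
move=> h0 ->; rewrite /sqp sqr_ge0/= expr_le1// ?le_max ?lexx//.
rewrite ge_max ler01/= mulrAC ler_pdivrMr ?exprn_gt0// mul1r.
(* This square equals [h^2 - 4 (y - a) (a + h - y)]. *)
by have := sqr_ge0 (2 * (y - a) - h); rewrite !expr2; nra.
Qed.

Lemma cell_bump_range h k x : 0 < h -> 0 <= cell_bump h k x <= 1.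
Proof.
move=> h0; apply/andP; split.
  by apply: prodr_ge0 => j _; rewrite sqr_ge0.
apply: (@le_trans _ _ (\prod_(j < d) 1)); last by rewrite big1_eq.
apply: ler_prod => j _; apply: sqp_range => //.
by rewrite intrD mulrDl mul1r.
Qed.

Lemma cell_bump_gt0 h k x : 0 < h -> ocell h k x -> 0 < cell_bump h k x.
Proof.
move=> h0 kx; apply: prodr_gt0 => j _; have /andP[k1 k2] := kx j.
rewrite /sqp exprn_gt0// lt_max; apply/orP; right.
by rewrite mulr_gt0 ?divr_gt0 ?exprn_gt0// mulr_gt0// subr_gt0.
Qed.

Lemma cell_bump_eq0 h k x : 0 < h -> ~ ocell h k x -> cell_bump h k x = 0.
Proof.
move=> h0 /existsNP[j /negP]; rewrite negb_and -!leNgt => xk.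
apply/eqP; rewrite /cell_bump (bigD1 j)//= mulf_eq0; apply/orP; left.
rewrite /sqp max_l ?expr0n//.
rewrite mulr_ge0_le0 ?divr_ge0 ?exprn_ge0 ?(ltW h0)//.
have kh : (k 0 j + 1)%:~R * h = (k 0 j)%:~R * h + h by rewrite intrD mulrDl mul1r.
by case/orP : xk; rewrite ?kh => ?; nra.
Qed.

(* A smooth function that is positive exactly on the open cell; its plateau
   increases to the indicator of the open cell as [m] tends to infinity. *)
Definition cell_plateau h k (m : nat) x : R := 1 - (1 - cell_bump h k x) ^+ m.

Lemma cell_plateau_C1 h k m : C1 (cell_plateau h k m).
Proof.
have -> : cell_plateau h k m = fun x => 1 + -1 * \prod_(l < m) (1 + -1 * cell_bump h k x).
  by apply/funext => x; rewrite prodr_const card_ord !mulN1r.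
have Cc := @C1_cst R d.
apply: C1D; [exact: Cc|]; apply: C1M; [exact: Cc|]; apply: C1_prod => _.
apply: C1D; [exact: Cc|]; apply: C1M; [exact: Cc|exact: cell_bump_C1].
Qed.

Lemma cell_plateau_range h k m x : 0 < h -> 0 <= cell_plateau h k m x <= 1.
Proof.
move=> h0; have /andP[u0 u1] := cell_bump_range k x h0.
have u1' : 0 <= 1 - cell_bump h k x by rewrite subr_ge0.
rewrite /cell_plateau subr_ge0 exprn_ile1 ?lerBlDr ?lerDl ?exprn_ge0//.
Qed.

Lemma cell_plateau_eq0 h k m x : 0 < h -> ~ ocell h k x -> cell_plateau h k m x = 0.
Proof. by move=> h0 kx; rewrite /cell_plateau cell_bump_eq0// subr0 expr1n subrr. Qed.

Lemma cell_plateau_cvg h k x : 0 < h ->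
  cell_plateau h k ^~ x @ \oo --> (\1_(ocell h k) x : R).
Proof.
move=> h0; rewrite indicE.
have [kx|kx] := pselect (ocell h k x); [rewrite mem_set//|rewrite memNset//]; last first.
  have -> : (fun m => cell_plateau h k m x) = cst 0.
    by apply/funext => m; rewrite cell_plateau_eq0.
  exact: cvg_cst.
have u0 := cell_bump_gt0 h0 kx; have /andP[_ u1] := cell_bump_range k x h0.
have z1 : `|1 - cell_bump h k x| < 1.
  by rewrite ger0_norm ?subr_ge0// ltrBlDr ltrDl.
have cz := cvg_expr z1.
by rewrite /cell_plateau -[X in _ --> X](subr0 1); exact: (cvgB (cvg_cst _) cz).
Qed.

End CellBump.

(** * Discrete variation and perimeter *)

Section DiscreteVariation.
Context (R : realType) (d : nat).
Implicit Types (f g : 'rV[R]_d -> R) (x v : 'rV[R]_d) (i j : 'I_d) (k : 'rV[int]_d) (h : R).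
Implicit Types (A B : set 'rV[R]_d).

(** Dominated convergence with the constant 1 on [B]. The limit is the volume in the open cell,
    which [leb_setI_cell] identifies with that in the closed one. *)
Lemma Rintegral_plateau_cvg B h k : lmeasurable B -> (leb B < +oo)%E -> 0 < h ->
  \int[@leb R d]_(x in B) cell_plateau h k m x @[m --> \oo] --> vol (B `&` cell h k).
Proof.
move=> mB Bf h0.
have cp m : continuous (cell_plateau h k m) by exact/C1_continuous/cell_plateau_C1.
have pr m x : `|cell_plateau h k m x| <= 1.
  by have /andP[p0 p1] := cell_plateau_range k m x h0; rewrite ger0_norm.
have mE m : measurable_fun (B : set (lebesgue_type R d)) (EFin \o (cell_plateau h k m : lebesgue_type R d -> R)).
  by apply/measurable_EFinP; exact: lmeasurable_continuous.
have i1 : (@leb R d).-integrable (B : set (lebesgue_type R d)) (EFin \o cst 1).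
  apply: (@integrable_continuous _ _ (cst 1) B 1) => //; first exact: cst_continuous.
  by move=> x; rewrite normr1.
have := @dominated_cvg _ (lebesgue_type R d) R (@leb R d) B mB
  (fun m => EFin \o cell_plateau h k m) (EFin \o \1_(ocell h k)) (EFin \o cst 1) mE.
have cvE x : B x -> (EFin \o cell_plateau h k m) x @[m --> \oo] --> (EFin \o \1_(ocell h k)) x.
  by move=> _; apply: cvg_EFin; [exact: nearW|exact: cell_plateau_cvg].
move=> /(_ cvE (fun x _ => isT) i1) H.
have {}H : (\int[@leb R d]_(x in (B : set (lebesgue_type R d))) (cell_plateau h k m x)%:E)%E
    @[m --> \oo] --> (leb (B `&` cell h k)).
  rewrite leb_setI_cell setIC -[leb _]integral_indic//; last exact: lmeasurable_ocell.
  by apply: H => m x Bx /=; rewrite lee_fin.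
apply: fine_cvg; rewrite fineK//.
rewrite ge0_fin_numE ?leb_ge0// (le_lt_trans _ Bf)//.
by apply: le_leb => x [].
Qed.

(** One test function treats all cells together: the plateaus are added with the signs of the
    differences to be summed. Translation by [h e_i] replaces each cell by its predecessor,
    [per_diff_le] bounds the resulting signed sum, and [m] then tends to infinity. *)
Lemma discrete_variation_le B h i (T : finType) (kap : T -> 'rV[int]_d) :
  injective kap -> lmeasurable B -> (leb B < +oo)%E -> (perimeter B < +oo)%E -> 0 < h ->
  \sum_t `|vol (B `&` cell h (kap t - delta_mx 0 i)) - vol (B `&` cell h (kap t))|
  <= h * per B.
Proof.
move=> ik mB Bf Bp h0.
pose a k : R := vol (B `&` cell h k).
pose s t : R := if 0 <= a (kap t - delta_mx 0 i) - a (kap t) then 1 else -1.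
have sE t : `|a (kap t - delta_mx 0 i) - a (kap t)| = s t * (a (kap t - delta_mx 0 i) - a (kap t)).
  rewrite /s; case: leP => [?|?]; rewrite ?mul1r ?mulN1r.
    by rewrite ger0_norm.
  by rewrite ltr0_norm.
pose Phi m x := \sum_t s t * cell_plateau h (kap t) m x.
have sn t : `|s t| = 1 by rewrite /s; case: leP; rewrite ?normrN normr1.
(* At each point at most one plateau is nonzero, because the open cells are disjoint and [kap] is
   injective. *)
have Phi1 m x : `|Phi m x| <= 1.
  have pr t : `|cell_plateau h (kap t) m x| <= 1.
    by have /andP[p0 p1] := cell_plateau_range (kap t) m x h0; rewrite ger0_norm.
  have [[t tx]|nx] := pselect (exists t, ocell h (kap t) x).
    rewrite /Phi (bigD1 t)//= big1 ?addr0; first by rewrite normrM sn mul1r.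
    move=> u ut; rewrite cell_plateau_eq0 ?mulr0// => ux.
    by move/eqP: ut; apply; apply: ik; exact: (ocell_cell_inj h0 ux (ocell_sub tx)).
  rewrite /Phi big1 ?normr0// => t _; rewrite cell_plateau_eq0 ?mulr0// => tx.
  by apply: nx; exists t.
have PhiC m : C1c (Phi m).
  have [dP cP] : C1 (Phi m).
    apply: C1_sum => t; apply: C1M; [exact: C1_cst|exact: cell_plateau_C1].
  split => //; exists (\sum_t \sum_j (`|(kap t 0 j)%:~R * h| + h)) => x Px j.
  have [[t tx]|nx] := pselect (exists t, ocell h (kap t) x); last first.
    exfalso; move/eqP: Px; apply; rewrite /Phi big1// => t _.
    by rewrite cell_plateau_eq0 ?mulr0// => tx; apply: nx; exists t.
  have nn u l : 0 <= `|(kap u 0 l)%:~R * h| + h by rewrite addr_ge0// ltW.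
  rewrite (bigD1 t)//= (bigD1 j)//= -addrA ler_wpDr//.
    by rewrite addr_ge0// sumr_ge0// => u _; rewrite ?sumr_ge0.
  have /andP[] := tx j; rewrite intrD mulrDl mul1r; move: (_ * h) => y ? ?.
  have := ler_norm y; have := ler_norm (- y); rewrite normrN => ? ?.
  by rewrite ler_norml; apply/andP; split; lra.
have intP m k : (@leb R d).-integrable (B : set (lebesgue_type R d))
    (EFin \o cell_plateau h k m).
  apply: (@integrable_continuous _ _ _ B 1) => //.
    exact/C1_continuous/cell_plateau_C1.
  move=> x; have /andP[p0 p1] := cell_plateau_range k m x h0.
  by rewrite ger0_norm.
have intS m (q : T -> 'rV[int]_d) :
    \int[@leb R d]_(x in B) (\sum_t s t * cell_plateau h (q t) m x) =
    \sum_t s t * \int[@leb R d]_(x in B) cell_plateau h (q t) m x.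
  elim: (index_enum T) => [|t r IH].
    by rewrite big_nil; under eq_Rintegral do rewrite big_nil; rewrite Rintegral_cst// mul0r.
  rewrite big_cons; under eq_Rintegral do rewrite big_cons.
  have iM u : (@leb R d).-integrable (B : set (lebesgue_type R d))
      (EFin \o (fun x => s u * cell_plateau h (q u) m x)).
    rewrite (_ : EFin \o _ = fun x => ((s u)%:E * (EFin \o cell_plateau h (q u) m) x)%E)//.
    exact: integrableZl.
  rewrite RintegralD//; first by rewrite IH RintegralZl.
  rewrite (_ : EFin \o _ =
      fun x => (\sum_(u <- r) (EFin \o (fun x => s u * cell_plateau h (q u) m x)%R) x)%E).
    exact: integrable_sum.
  by apply/funext => x /=; rewrite sumEFin.
under eq_bigr do rewrite sE.
have cv : (\sum_t s t * (\int[@leb R d]_(x in B) cell_plateau h (kap t - delta_mx 0 i) m x -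
     \int[@leb R d]_(x in B) cell_plateau h (kap t) m x)) @[m --> \oo] -->
   \sum_t s t * (a (kap t - delta_mx 0 i) - a (kap t)).
  apply: cvg_big => [|t _]; first exact: add_continuous.
  apply: cvgM; first exact: cvg_cst.
  by apply: cvgB; exact: Rintegral_plateau_cvg.
apply: (cvgr_to_le cv); apply: nearW => m.
have := @per_diff_le _ _ (Phi m) i B h mB Bf Bp (PhiC m) (Phi1 m) (ltW h0).
have -> : \int[@leb R d]_(x in B) Phi m (x + h *: delta_mx 0 i) =
    \int[@leb R d]_(x in B) (\sum_t s t * cell_plateau h (kap t - delta_mx 0 i) m x).
  apply: eq_Rintegral => x _; apply: eq_bigr => t _.
  by rewrite /cell_plateau cell_bump_shift.
rewrite (intS m kap) (intS m (fun t => kap t - delta_mx 0 i)).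
by under [X in _ -> X <= _]eq_bigr do rewrite mulrBr; rewrite sumrB.
Qed.

End DiscreteVariation.

(** * Dyadic figures and grids *)

Section Figure.
Context (R : realType) (d : nat).
Implicit Types (x v : 'rV[R]_d) (i j : 'I_d) (k : 'rV[int]_d) (h : R).
Implicit Types (A B : set 'rV[R]_d) (S : seq 'rV[int]_d).

Definition figure h S : set 'rV[R]_d := [set x | exists2 k, k \in S & cell h k x].

Lemma figure_nil h : figure h [::] = set0.
Proof. by apply/seteqP; split => x // []. Qed.

Lemma figure_cons h k S : figure h (k :: S) = cell h k `|` figure h S.
Proof.
apply/seteqP; split => x.
  by move=> [l]; rewrite inE => /predU1P[->|lS] lx; [left|right; exists l].
by move=> [kx|[l lS lx]]; [exists k => //; rewrite mem_head|exists l => //; rewrite inE lS orbT].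
Qed.

Lemma lmeasurable_figure h S : lmeasurable (figure h S).
Proof.
elim: S => [|k S IH]; first by rewrite figure_nil; exact: lmeasurable0.
by rewrite figure_cons; apply: lmeasurableU => //; exact: lmeasurable_cell.
Qed.

Lemma leb_bigcup_le (T : eqType) (s : seq T) (F : T -> set 'rV[R]_d) :
  (leb [set x | exists2 t, t \in s & F t x] <= \sum_(t <- s) leb (F t))%E.
Proof.
elim: s => [|t s IH].
  rewrite big_nil (_ : [set _ | _] = set0) ?measure0//.
  by apply/seteqP; split => x // [].
rewrite big_cons; apply: le_trans (leeD (lexx _) IH).
apply: le_trans (lebU_le _ _); apply: le_leb => x [u].
by rewrite inE => /predU1P[->|us] Fu; [left|right; exists u].
Qed.

Lemma leb_figure_fin h S : 0 <= h -> (leb (figure h S) < +oo)%E.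
Proof.
move=> h0; apply: le_lt_trans (leb_bigcup_le _ _) _.
rewrite (@le_lt_trans _ _ (\sum_(k <- S) (h ^+ d)%:E)%E)//; last by rewrite sumEFin ltry.
by apply: lee_sum => k _; exact: leb_cell_le.
Qed.

Lemma figure_cell_inter0 h k S : 0 < h -> k \notin S ->
  leb (cell h k `&` figure h S) = 0%E.
Proof.
move=> h0 kS.
rewrite (_ : _ `&` _ = [set x | exists2 l, l \in S & (cell h k `&` cell h l) x]).
  apply: leb_bigcup0 => l lS; apply: leb_cell_inter0 => //.
  by apply: contraNneq kS => ->.
by apply/seteqP; split => x [] => [kx [l lS lx]|l lS [kx lx]]; [exists l|split => //; exists l].
Qed.

Lemma vol_fin A : (leb A < +oo)%E -> leb A = (vol A)%:E.
Proof. by move=> Af; rewrite /vol fineK// ge0_fin_numE ?leb_ge0. Qed.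

Lemma volU A B : lmeasurable A -> lmeasurable B ->
  (leb A < +oo)%E -> (leb B < +oo)%E -> leb (A `&` B) = 0%E ->
  vol (A `|` B) = vol A + vol B.
Proof.
move=> mA mB Af Bf AB0.
have ABf : (leb (A `|` B) < +oo)%E.
  by rewrite (le_lt_trans (lebU_le _ _))// lte_add_pinfty.
apply: EFin_inj; rewrite EFinD -!vol_fin//.
rewrite (leb_setIC (A `|` B) mA).
have -> : (A `|` B) `&` A = A by apply/seteqP; split => x; [case|split => //; left].
congr (_ + _)%E; rewrite (leb_setIC B mA) (setIC B A) AB0 add0e.
by congr leb; apply/seteqP; split => x [] => [[Ax|Bx] nAx|Bx nAx] //; split => //; right.
Qed.

Lemma vol_setI_figure A h S : lmeasurable A -> (leb A < +oo)%E -> 0 < h -> uniq S ->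
  vol (A `&` figure h S) = \sum_(k <- S) vol (A `&` cell h k).
Proof.
move=> mA Af h0; have AIf B : (leb (A `&` B) < +oo)%E.
  by apply: le_lt_trans Af; apply: le_leb => x [].
elim: S => [_|k S IH /andP[kS uS]].
  by rewrite figure_nil setI0 big_nil /vol measure0.
rewrite big_cons -IH// figure_cons setIUr volU//.
- by apply: lmeasurableI => //; exact: lmeasurable_cell.
- by apply: lmeasurableI => //; exact: lmeasurable_figure.
- apply: leb_sub0 (figure_cell_inter0 h0 kS) => x [[? ?] [? ?]]; by split.
Qed.

Lemma leb_slab_le (a b : 'rV[R]_d) i (t h : R) : 0 <= t -> 0 <= h ->
  (forall j, b 0 j - a 0 j = if j == i then t else h) ->
  (leb (cbox a b) <= (t * h ^+ d.-1)%:E)%E.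
Proof.
move=> t0 h0 ab; apply: le_trans (leb_cbox_le _ _) _.
rewrite lee_fin (bigD1 i)//= ab eqxx max_r//.
rewrite (eq_bigr (fun=> h)); last by move=> j ji; rewrite ab (negbTE ji) max_r.
by rewrite prodr_const cardC1 card_ord.
Qed.

(** A small translation by [t e_i] changes the figure only inside slabs of thickness [t] along its
    exposed faces orthogonal to [e_i]. Each slab has measure at most [t h^(d-1)], and
    [derive_flux_le] divides by [t]. *)
Lemma figure_flux_le h S i f : 0 < h -> C1c f -> (forall x, `|f x| <= 1) ->
  \int[@leb R d]_(x in figure h S) 'D_(delta_mx 0 i) f x <=
  h ^+ d.-1 * (count (fun k => k - delta_mx 0 i \notin S) S)%:R +
  h ^+ d.-1 * (count (fun k => k + delta_mx 0 i \notin S) S)%:R.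
Proof.
move=> h0 Cf f1.
have cntE (P : pred 'rV[int]_d) t (F : 'rV[int]_d -> set 'rV[R]_d) : 0 <= t ->
    (forall k, (leb (F k) <= (t * h ^+ d.-1)%:E)%E) ->
    (leb [set x | exists2 k, k \in [seq k <- S | P k] & F k x] <= (t * (h ^+ d.-1 * (count P S)%:R))%:E)%E.
  move=> t0 Fk; apply: le_trans (leb_bigcup_le _ _) _.
  apply: (@le_trans _ _ (\sum_(k <- [seq k <- S | P k]) (t * h ^+ d.-1)%:E)%E).
    by apply: lee_sum => k _; exact: Fk.
  by rewrite sumEFin lee_fin big_const_seq iter_addr_0 count_predT size_filter mulrA mulr_natr.
(* With [t < h] a translation cannot skip over a neighbouring cell. *)
apply: (@derive_flux_le _ _ f i _ _ _ h) => //.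
- exact: lmeasurable_figure.
- by apply: leb_figure_fin; exact: ltW.
move=> t /andP[t0 th]; split.
(* Points lost by the translation lie just above the lower face of a cell whose predecessor is not
   in [S]. *)
- pose F k := cbox (\row_j ((k 0 j)%:~R * h))
    (\row_j (if j == i then (k 0 j)%:~R * h + t else (k 0 j + 1)%:~R * h)).
  apply: le_trans (cntE _ t F (ltW t0) _); last first.
    move=> k; apply: (@leb_slab_le _ _ i); rewrite ?ltW// => j; rewrite !mxE.
    by case: eqP => _; rewrite ?intrD; ring.
  apply: le_leb => x [[k kS kx]] /= nx.
  have xi : x 0 i - t < (k 0 i)%:~R * h.
    rewrite ltNge; apply/negP => xi; apply: nx; exists k => // j.
    rewrite !mxE eqxx/=; have := kx j.
    case: eqP => [->|_]; rewrite ?mulr0 ?subr0// mulr1.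
    by move=> /andP[? ?]; apply/andP; split => //; lra.
  exists k; rewrite ?mem_filter ?kS ?andbT//.
    apply/negP => kS'; apply: nx; exists (k - delta_mx 0 i) => // j.
    rewrite !mxE eqxx/=; have := kx j.
    case: eqP => [->|_]; rewrite ?mulr0 ?subr0// mulr1 subrK intrB mulrBl mul1r.
    move=> /andP[? ?]; apply/andP; split; last exact: ltW.
    lra.
  move=> j; rewrite !mxE; have := kx j => /andP[k1 k2]; rewrite k1/=.
  by case: eqP => [->|//]; lra.
(* Points gained lie just beyond the upper face of a cell whose successor is not in [S]. *)
- pose F k := cbox (\row_j (if j == i then (k 0 j + 1)%:~R * h else (k 0 j)%:~R * h))
    (\row_j (if j == i then (k 0 j + 1)%:~R * h + t else (k 0 j + 1)%:~R * h)).
  apply: le_trans (cntE _ t F (ltW t0) _); last first.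
    move=> k; apply: (@leb_slab_le _ _ i); rewrite ?ltW// => j; rewrite !mxE.
    by case: eqP => _; rewrite ?intrD; ring.
  apply: le_leb => x [[k kS kx]] /= nx.
  have xj j : j != i -> (k 0 j)%:~R * h <= x 0 j <= (k 0 j + 1)%:~R * h.
    by move=> ji; have := kx j; rewrite !mxE eqxx (negbTE ji) mulr0 subr0.
  have xit : (k 0 i)%:~R * h <= x 0 i - t <= (k 0 i + 1)%:~R * h.
    by have := kx i; rewrite !mxE !eqxx mulr1.
  have xi : (k 0 i + 1)%:~R * h < x 0 i.
    rewrite ltNge; apply/negP => xi; apply: nx; exists k => // j.
    have [->|ji] := eqVneq j i; last exact: xj.
    by move: xit => /andP[? ?]; apply/andP; split => //; lra.
  exists k; rewrite ?mem_filter ?kS ?andbT//.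
    apply/negP => kS'; apply: nx; exists (k + delta_mx 0 i) => // j.
    rewrite !mxE eqxx/=; have [->|ji] := eqVneq j i; last first.
      by rewrite addr0; exact: xj.
    rewrite (ltW xi)/= [(_ + 1)%:~R]intrD mulrDl mul1r.
    by move: xit => /andP[? ?]; lra.
  move=> j; rewrite !mxE; have [->|ji] := eqVneq j i; last exact: xj.
  rewrite (ltW xi)/=; by move: xit => /andP[? ?]; lra.
Qed.

Lemma figure_perimeter_le h S : 0 < h ->
  (perimeter (figure h S) <= (h ^+ d.-1 * \sum_i
    ((count (fun k => k - delta_mx 0 i \notin S) S)%:R +
     (count (fun k => k + delta_mx 0 i \notin S) S)%:R))%R%:E)%E.
Proof.
move=> h0; rewrite mulr_sumr; apply: perimeter_le.
- exact: lmeasurable_figure.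
- by apply: leb_figure_fin; exact: ltW.
- move=> f i Cf f1; rewrite mulrDr; exact: figure_flux_le.
Qed.

End Figure.

(** * The dyadic grid of the unit cube *)

Section Grid.
Context (R : realType) (d : nat).
Implicit Types (x v : 'rV[R]_d) (i j : 'I_d) (k : 'rV[int]_d) (h : R).
Implicit Types (A B : set 'rV[R]_d) (S : seq 'rV[int]_d).

Definition mesh (n : nat) : R := (2 ^+ n)^-1.

Lemma mesh_gt0 n : 0 < mesh n.
Proof. by rewrite invr_gt0 exprn_gt0. Qed.

Lemma mesh_mul n : (2 ^ n)%:R * mesh n = 1.
Proof. by rewrite natrX mulfV// expf_neq0. Qed.

Lemma meshS n : mesh n = 2 * mesh n.+1.
Proof. by rewrite /mesh exprS invfM mulrA divff// mul1r. Qed.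

Definition grid_key n (f : {ffun 'I_d -> 'I_(2 ^ n)}) : 'rV[int]_d :=
  \row_i (f i : nat)%:Z.

Definition grid n : seq 'rV[int]_d :=
  [seq grid_key f | f <- enum {: {ffun 'I_d -> 'I_(2 ^ n)}}].

Lemma grid_key_inj n : injective (@grid_key n).
Proof.
move=> f g /rowP fg; apply/ffunP => i; apply: val_inj.
by have := fg i; rewrite !mxE => -[].
Qed.

Lemma grid_uniq n : uniq (grid n).
Proof. by rewrite map_inj_uniq ?enum_uniq//; exact: grid_key_inj. Qed.

Lemma mem_gridP n k : reflect (forall i, 0 <= k 0 i < (2 ^ n)%N) (k \in grid n).
Proof.
apply: (iffP mapP) => [[f _ ->] i|kn].
  by rewrite mxE lez_nat ltz_nat ltn_ord.
have kn' i : (absz (k 0%R i) < 2 ^ n)%N.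
  by have := kn i; case: (k 0 i) => [m|m] //=.
exists [ffun i => Ordinal (kn' i)]; first by rewrite mem_enum.
apply/rowP => i; rewrite mxE ffunE /=.
by have := kn i; case: (k 0 i) => [m|m].
Qed.

Lemma grid_cell_unit n k : k \in grid n -> cell (mesh n) k `<=` @unit_cube R d.
Proof.
move=> /mem_gridP kn x kx i.
have /andP[k0 k1] := kn i; have /andP[x0 x1] := kx i.
apply/andP; split.
  by apply: le_trans x0; rewrite mulr_ge0 ?ler0z// ltW// mesh_gt0.
apply: (le_trans x1); rewrite -[leRHS](mesh_mul n) ler_pM2r ?mesh_gt0//.
by rewrite -[(2 ^ n)%:R]/(((2 ^ n)%N : int)%:~R : R) ler_int; lia.
Qed.

Lemma unit_cube_grid n x : @unit_cube R d x -> exists2 k, k \in grid n & cell (mesh n) k x.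
Proof.
move=> ux; pose N : int := (2 ^ n)%N.
have N0 : 0 < N by rewrite ltz_nat expn_gt0.
(* The cap at [N - 1] puts points with a coordinate equal to 1 into the last cell. *)
pose k : 'rV[int]_d := \row_i Num.min (Num.floor (x 0 i / mesh n)) (N - 1).
exists k.
  apply/mem_gridP => i; rewrite mxE le_min gt_min.
  have /andP[x0 x1] := ux i.
  rewrite floor_ge0 divr_ge0 ?(ltW (mesh_gt0 n))//=.
  by apply/andP; split; [lia|apply/orP; right; lia].
move=> i; rewrite mxE; have /andP[x0 x1] := ux i; apply/andP; split.
  rewrite -ler_pdivlMr ?mesh_gt0// (le_trans _ (floor_le _))//.
  by rewrite ler_int ge_min lexx.
rewrite -ler_pdivrMr ?mesh_gt0//.
have [?|?] := leP (Num.floor (x 0 i / mesh n)) (N - 1).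
  exact/ltW/floorD1_gt.
rewrite subrK /mesh invrK; rewrite -[X in _ <= X]mul1r.
by rewrite /N -pmulrn natrX ler_wpM2r ?exprn_ge0.
Qed.

(** Neighbours of grid cells may leave the grid; this lets them count as cells of density 0 for any
    set in the cube. *)
Lemma notin_grid_cell0 n k : k \notin grid n -> leb (@unit_cube R d `&` cell (mesh n) k) = 0%E.
Proof.
move=> /mem_gridP/existsNP[i /negP]; rewrite negb_and -ltNge -leNgt => ki.
pose a : 'rV[R]_d := \row_j Num.max 0 ((k 0 j)%:~R * mesh n).
pose b : 'rV[R]_d := \row_j Num.min 1 ((k 0 j + 1)%:~R * mesh n).
apply: (@leb_sub0 _ _ _ (cbox a b)).
  move=> x [ux kx] j; rewrite !mxE ge_max le_min.
  by have /andP[-> ->] := ux j; have /andP[-> ->] := kx j.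
apply: (@leb_cbox0 _ _ _ _ i); rewrite !mxE.
case/orP: ki => ki.
  apply: (@le_trans _ _ ((k 0 i + 1)%:~R * mesh n)).
    by rewrite ge_min lexx orbT.
  rewrite le_max; apply/orP; left.
  by rewrite mulr_le0_ge0 ?(ltW (mesh_gt0 n))// lerz0; lia.
apply: (@le_trans _ _ 1); first by rewrite ge_min lexx.
rewrite le_max; apply/orP; right.
rewrite -[leLHS](mesh_mul n) ler_pM2r ?mesh_gt0//.
by rewrite -[(2 ^ n)%:R]/(((2 ^ n)%N : int)%:~R : R) ler_int.
Qed.

Lemma mesh_cvg0 : mesh n @[n --> \oo] --> 0.
Proof.
rewrite (_ : (fun n => mesh n) = GRing.exp (2^-1 : R)); last first.
  by apply/funext => n; rewrite /mesh exprVn.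
by apply: cvg_expr; rewrite ger0_norm ?invr_ge0// invf_lt1// ltr1n.
Qed.

Lemma leb_decr_small (F : nat -> set 'rV[R]_d) (e : R) :
  (forall n, lmeasurable (F n)) -> (leb (F 0%N) < +oo)%E -> nonincreasing_seq F ->
  \bigcap_n F n = set0 -> 0 < e ->
  exists N, forall n, (N <= n)%N -> (leb (F n) <= e%:E)%E.
Proof.
move=> mF F0 dF F00 e0.
have := @nonincreasing_cvg_mu _ _ R (@leb R d) F F0 mF.
rewrite F00 measure0 => /(_ measurable0 dF) /fine_cvgP[_ /cvgrPdist_le/(_ _ e0)[N _ HN]].
exists N => n Nn; have := HN n Nn; rewrite /= sub0r normrN.
rewrite ger0_norm ?fine_ge0 ?leb_ge0// => H.
rewrite -(@fineK _ (leb (F n))) ?lee_fin//.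
rewrite ge0_fin_numE ?leb_ge0// (le_lt_trans _ F0)// le_leb//.
exact/subsetPset/dF.
Qed.

Definition thicken A (r : R) : set 'rV[R]_d :=
  [set x | exists2 y, A y & forall i, `|x 0 i - y 0 i| <= r].

(** Since the box is closed, its collars decrease to the empty set, and continuity of the measure
    from above applies. *)
Lemma box_collar_small (Q : box R d) (e : R) : 0 < e ->
  exists N, forall n, (N <= n)%N ->
    (leb (thicken (box_set Q) (mesh n) `\` box_set Q) <= e%:E)%E.
Proof.
move=> e0; case: Q => [[a b]|]; last first.
  exists 0%N => n _; rewrite (_ : _ `\` _ = set0) ?measure0 ?lee_fin ?ltW//.
  by apply/seteqP; split => x // [[y]].
pose F n := cbox (\row_i (a 0 i - mesh n)) (\row_i (b 0 i + mesh n)) `\` cbox a b.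
have [||||N HN] := @leb_decr_small F e _ _ _ _ e0.
- by move=> n; apply: lmeasurableD; exact: lmeasurable_cbox.
- apply: le_lt_trans (ltry _); apply: le_trans (leb_cbox_le
    (\row_i (a 0 i - mesh 0)) (\row_i (b 0 i + mesh 0))).
  by apply: le_leb => x [].
- apply/nonincreasing_seqP => n; apply/subsetPset => x [Fx nx]; split => // i.
  have := Fx i; rewrite !mxE (meshS n); have := mesh_gt0 n.+1.
  by move=> ? /andP[? ?]; apply/andP; split; lra.
- rewrite -subset0 => x Fx; have [_ /existsNP[i]] := Fx 0%N I; apply.
  have H n : a 0 i - mesh n <= x 0 i <= b 0 i + mesh n.
    by have [/(_ i)] := Fx n I; rewrite !mxE.
  apply/andP; split.
    have c : a 0 i - mesh n @[n --> \oo] --> a 0 i.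
      by rewrite -[X in _ --> X]subr0; apply: cvgB; [exact: cvg_cst|exact: mesh_cvg0].
    by apply: (cvgr_to_le c); apply: nearW => n; have /andP[] := H n.
  have c : b 0 i + mesh n @[n --> \oo] --> b 0 i.
    by rewrite -[X in _ --> X]addr0; apply: cvgD; [exact: cvg_cst|exact: mesh_cvg0].
  by apply: (cvgr_to_ge c); apply: nearW => n; have /andP[] := H n.
exists N => n /HN; apply: le_trans; apply: le_leb => x [[y ab xy] nx]; split => // i.
rewrite !mxE; have := xy i; have /andP[? ?] := ab i.
by rewrite ler_norml => /andP[? ?]; apply/andP; split; lra.
Qed.

End Grid.

(** * Approximation in measure by dyadic figures *)

Section Approximation.
Context (R : realType) (d : nat).
Implicit Types (x v : 'rV[R]_d) (i j : 'I_d) (k : 'rV[int]_d) (h : R).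
Implicit Types (A B : set 'rV[R]_d) (S : seq 'rV[int]_d).

Lemma leb_unit_cube_fin B : B `<=` @unit_cube R d -> (leb B < +oo)%E.
Proof.
move=> Bu; apply: le_lt_trans (ltry _).
apply: le_trans (leb_cbox_le (const_mx 0) (const_mx 1)).
by apply: le_leb => x /Bu ux i; rewrite !mxE.
Qed.

Lemma box_collars_small (Q : nat -> box R d) (M : nat) (e : R) : 0 < e ->
  exists N, forall n, (N <= n)%N ->
    (leb [set x | exists2 k, (k < M)%N &
       (thicken (box_set (Q k)) (mesh R n) `\` box_set (Q k)) x] <= e%:E)%E.
Proof.
elim: M e => [|M IH] e e0.
  exists 0%N => n _; rewrite (_ : [set _ | _] = set0) ?measure0 ?lee_fin ?ltW//.
  by apply/seteqP; split => x // [].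
have e2 : 0 < e / 2 by rewrite divr_gt0.
have [N1 H1] := IH _ e2; have [N2 H2] := box_collar_small (Q M) e2.
exists (maxn N1 N2) => n; rewrite geq_max => /andP[/H1 {}H1 /H2 {}H2].
rewrite [e]splitr EFinD; apply: le_trans (leeD H1 H2).
apply: le_trans (lebU_le _ _); apply: le_leb => x [k].
rewrite ltnS leq_eqVlt => /predU1P[->|kM] kx; [by right|by left; exists k].
Qed.

(** Take a cover of [B] by boxes with excess at most [e / 2], keep finitely many of them, and select
    the cells that meet these. What is missed is a tail of the cover; what is added lies in the
    excess or in the collars of the kept boxes. The perimeter is not controlled: these figures are
    references for [superlevel_close]. *)
Lemma approx_figure B (e : R) : lmeasurable B -> B `<=` @unit_cube R d -> 0 < e ->
  exists N, forall n, (N <= n)%N -> exists S, [/\ uniq S, {subset S <= grid d n},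
    (leb (B `\` figure (mesh R n) S) <= e%:E)%E & (leb (figure (mesh R n) S `\` B) <= e%:E)%E].
Proof.
move=> mB Bu e0; have e2 : 0 < e / 2 by rewrite divr_gt0.
have Bf := leb_unit_cube_fin Bu.
have Bfin : leb B \is a fin_num by rewrite ge0_fin_numE ?leb_ge0.
have [_ [Q BQ <-] /ltW Qe] := lb_ereal_inf_adherent e2 Bfin.
pose U (k : nat) : set 'rV[R]_d := box_set (Q k).
have mU (k : nat) : lmeasurable (U k).
  rewrite /U; case: (Q k) => [[a b]|]; [exact: lmeasurable_cbox|exact: lmeasurable0].
have U_le (k : nat) : (leb (U k) <= (box_vol (Q k))%:E)%E.
  by rewrite /U; case: (Q k) => [[a b]|] /=; [exact: leb_cbox_le|rewrite measure0].
pose W := \bigcup_k U k.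
have WB : (leb (W `\` B) <= (e / 2)%:E)%E.
  have : (leb W <= leb B + (e / 2)%:E)%E.
    apply: le_trans Qe; apply: le_trans (outer_measure_sigma_subadditive _ _) _.
    by apply: lee_nneseries => [k _ _|k _]; [exact: leb_ge0|exact: U_le].
  rewrite (leb_setIC W mB) (_ : W `&` B = B) ?leeD2lE//.
  by apply/setIidPr.
have [||||N0 HN0] := @leb_decr_small R d (fun N => B `\` \bigcup_(k in `I_N) U k) e _ _ _ _ e0.
- move=> n; apply: lmeasurableD => //.
  by apply: bigcup_measurable => k _; exact: mU.
- by apply: le_lt_trans Bf; apply: le_leb => x [].
- apply/nonincreasing_seqP => n; apply/subsetPset => x [Bx nx]; split => // -[k kn Ux].
  by apply: nx; exists k => //; exact: ltnW.
- rewrite -subset0 => x Fx; have [Bx _] := Fx 0%N I; have [k _ Ux] := BQ x Bx.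
  by have [_] := Fx k.+1 I; apply; exists k => //=.
have [N1 HN1] := box_collars_small Q N0 e2.
exists N1 => n /HN1 {}HN1.
exists [seq k <- grid d n | `[< exists x, cell (mesh R n) k x /\ exists2 j, (j < N0)%N & U j x >]].
split.
- by rewrite filter_uniq// grid_uniq.
- by move=> k; rewrite mem_filter => /andP[].
- apply: le_trans (HN0 N0 (leqnn _)); apply: le_leb => x [Bx nx]; split => // -[j jN Ux].
  have [k kg kx] := unit_cube_grid n (Bu x Bx).
  apply: nx; exists k => //; rewrite mem_filter kg andbT.
  by apply/asboolP; exists x; split => //; exists j.
- rewrite [e]splitr EFinD; apply: le_trans (leeD WB HN1).
  apply: le_trans (lebU_le _ _); apply: le_leb => x [[k]].
  rewrite mem_filter => /andP[/asboolP[y [ky [j jN Uy]]] _] kx nBx.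
  have [Ux|nUx] := pselect (U j x); first by left; split => //; exists j.
  right; exists j => //; split => //; exists y => // i.
  exact: cell_dist kx ky.
Qed.

End Approximation.

(** * Approximation of BV sets by superlevel figures *)

Section Threshold.
Context (R : realType) (d : nat).
Implicit Types (x v : 'rV[R]_d) (i j : 'I_d) (k : 'rV[int]_d) (h t : R).
Implicit Types (A B : set 'rV[R]_d) (S : seq 'rV[int]_d).

Lemma exists_le_mean (M : nat) (c : 'I_M -> R) (X : R) : (0 < M)%N ->
  \sum_l c l <= X -> exists l, c l * M%:R <= X.
Proof.
move=> M0 cX; apply/not_existsP => H.
have : \sum_(l < M) (X / M%:R) < \sum_l c l.
  apply: ltr_sum; first by apply/hasP; exists (Ordinal M0); rewrite ?mem_index_enum.
  by move=> l _; rewrite ltr_pdivrMr ?ltr0n// ltNge; apply/negP.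
rewrite sumr_const card_ord -[X in X < _]mulr_natr divfK ?pnatr_eq0 -?lt0n//.
by rewrite ltNge cX.
Qed.

Definition superlevel B n t : seq 'rV[int]_d :=
  [seq k <- grid d n | t * mesh R n ^+ d < vol (B `&` cell (mesh R n) k)].

Lemma superlevel_sub B n t : {subset superlevel B n t <= grid d n}.
Proof. by move=> k; rewrite mem_filter => /andP[]. Qed.

Lemma superlevel_uniq B n t : uniq (superlevel B n t).
Proof. by rewrite filter_uniq// grid_uniq. Qed.

Lemma vol_ge0 A : 0 <= vol A.
Proof. by rewrite fine_ge0// leb_ge0. Qed.

Lemma vol_notin_grid B n k : B `<=` @unit_cube R d -> k \notin grid d n ->
  vol (B `&` cell (mesh R n) k) = 0.
Proof.
move=> Bu kn; rewrite /vol (@leb_sub0 _ _ _ (@unit_cube R d `&` cell (mesh R n) k)) ?notin_grid_cell0//.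
by apply: setSI.
Qed.

Lemma notin_superlevel B n t k : B `<=` @unit_cube R d -> 0 <= t ->
  k \notin superlevel B n t -> vol (B `&` cell (mesh R n) k) <= t * mesh R n ^+ d.
Proof.
move=> Bu t0; rewrite mem_filter negb_and -leNgt => /orP[//|kn].
by rewrite vol_notin_grid// mulr_ge0// exprn_ge0// ltW// mesh_gt0.
Qed.

(** The offset [z] covers both neighbours: [z = 0] compares [k] with [k - e_i], and [z = e_i]
    compares it with [k + e_i]. *)
Lemma grid_variation_le B n i (z : 'rV[int]_d) : lmeasurable B -> B `<=` @unit_cube R d ->
  (perimeter B < +oo)%E ->
  \sum_(k <- grid d n) `|vol (B `&` cell (mesh R n) (k + z - delta_mx 0 i)) -
     vol (B `&` cell (mesh R n) (k + z))| <= mesh R n * per B.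
Proof.
move=> mB Bu Bp; rewrite big_map big_enum/=.
apply: (@discrete_variation_le R d B (mesh R n) i _ (fun f => @grid_key d n f + z)) => //.
- by move=> f g /addIr/grid_key_inj.
- exact: leb_unit_cube_fin.
- exact: mesh_gt0.
Qed.

(** Compare the unit cell with its neighbour, which carries no volume of [B]. The bound makes
    [|B| / ||B||] at most 1, hence comparable to a dyadic mesh. *)
Lemma vol_le_per B : (0 < d)%N -> lmeasurable B -> B `<=` @unit_cube R d ->
  (perimeter B < +oo)%E -> vol B <= per B.
Proof.
move=> d0 mB Bu Bp; pose i := Ordinal d0.
have := @discrete_variation_le R d B (mesh R 0) i unit (fun=> 0) _ mB (leb_unit_cube_fin Bu) Bp (mesh_gt0 _ _).
rewrite big_const card_unit /= addr0 /mesh expr0 invr1 mul1r => H.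
apply: le_trans (H _); last by case=> -[].
have m1 : mesh R 0 = 1 by rewrite /mesh expr0 invr1.
have := @vol_notin_grid B 0 (0 - delta_mx 0 i) Bu; rewrite m1 => ->; last first.
  apply/mem_gridP => /(_ i)/andP[]; rewrite !mxE !eqxx.
  by rewrite sub0r.
rewrite sub0r normrN ger0_norm ?vol_ge0//.
rewrite (_ : B `&` _ = B)//; apply/setIidPl => x /Bu ux j.
by rewrite mxE mul0r add0r mul1r.
Qed.

(* Averages the perimeter over [M] equally spaced levels; the discretization
   error [J / M] is absorbed in the bound by taking [M] large. *)
Lemma exists_threshold B n : (0 < d)%N -> lmeasurable B -> B `<=` @unit_cube R d ->
  (perimeter B < +oo)%E -> 0 < per B ->
  exists2 t, 1 / 3 <= t <= 2 / 3 &
    (perimeter (figure (mesh R n) (superlevel B n t)) <= (8 * d%:R * per B)%:E)%E.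
Proof.
move=> d0 mB Bu Bp P0; set h := mesh R n; have h0 : 0 < h by exact: mesh_gt0.
pose b k : R := vol (B `&` cell h k).
pose hd := h ^+ d; have hd0 : 0 < hd by rewrite exprn_gt0.
pose V := \sum_i (\sum_(k <- grid d n) `|b (k + 0 - delta_mx 0 i) - b (k + 0)| +
                  \sum_(k <- grid d n) `|b (k + delta_mx 0 i - delta_mx 0 i) - b (k + delta_mx 0 i)|).
have V_le : V <= 2 * d%:R * (h * per B).
  apply: (@le_trans _ _ (\sum_(i < d) (2 * (h * per B)))); last first.
    by rewrite sumr_const card_ord -[leLHS]mulr_natl mulrCA mulrA.
  apply: ler_sum => i _; rewrite mulrDl mul1r.
  by apply: lerD; exact: grid_variation_le.
(* [J] is the number of comparisons between a cell and a neighbour; each of them costs one level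
   spacing in [count_grid]. *)
pose J : R := \sum_(i < d) \sum_(k <- grid d n) 2.
pose V0 := 2 * d%:R * (h * per B).
have V00 : 0 < V0 by rewrite !mulr_gt0 ?ltr0n.
have J0 : 0 <= J by apply: sumr_ge0 => i _; apply: sumr_ge0.
(* With the spacing [tau = 1 / (3 M)] chosen below, this makes the total discretization error
   [hd tau J] at most [V0 / 3]. *)
pose M := (Num.trunc (hd * J / V0)).+1.
have M0 : (0 < M%:R :> R) by rewrite ltr0n.
have JM : hd * J <= V0 * M%:R.
  by rewrite [leRHS]mulrC -ler_pdivrMr// ltW// truncnS_gt.
pose tau : R := (3 * M%:R)^-1.
have tau0 : 0 < tau by rewrite invr_gt0 mulr_gt0.
have tauM : 3 * (tau * M%:R) = 1.
  by rewrite mulrA (mulrC 3) -mulrA mulrC mulfV// mulf_neq0// lt0r_neq0.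
pose t (l : 'I_M) : R := 1 / 3 + l%:R * tau.
have t13 l : 1 / 3 <= t l <= 2 / 3.
  rewrite /t lerDl mulr_ge0 ?(ltW tau0)//=.
  have : l%:R * tau <= M%:R * tau by rewrite ler_pM2r// ler_nat ltnW.
  by rewrite (mulrC _ tau); lra.
(* A face is exposed at level [t l] only if this level separates the densities on its two sides. *)
pose ind (x y : R) l : R := (x <= t l * hd <= y)%R%:R.
have ind_sum (x y : R) : hd * tau * \sum_l ind x y l <= `|x - y| + hd * tau.
  have := @count_grid R (hd * tau) (x - hd / 3) (y - hd / 3) M (mulr_gt0 hd0 tau0).
  have -> : \sum_(l < M) (x - hd / 3 <= l%:R * (hd * tau) <= y - hd / 3)%R%:R = \sum_l ind x y l.
    apply: eq_bigr => l _; rewrite /ind /t lerBlDr lerBrDr.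
    by have -> : l%:R * (hd * tau) + hd / 3 = (1 / 3 + l%:R * tau) * hd by ring.
  move/le_trans; apply; rewrite lerD2r ge_max normr_ge0/= distrC.
  by rewrite opprB addrA subrK ler_norm.
pose c l := \sum_i \sum_(k <- grid d n)
   (ind (b (k - delta_mx 0 i)) (b k) l + ind (b (k + delta_mx 0 i)) (b k) l).
have cX : \sum_l c l <= (V0 + hd * tau * J) / (hd * tau).
  rewrite ler_pdivlMr ?mulr_gt0// mulrC.
  apply: le_trans (lerD V_le (lexx (hd * tau * J))).
  rewrite /c exchange_big/= !mulr_sumr -big_split/=.
  apply: ler_sum => i _; rewrite exchange_big/= !mulr_sumr -!big_split/=.
  apply: ler_sum => k _; rewrite big_split/= mulrDr addr0 addrK.
  have := ind_sum (b (k - delta_mx 0 i)) (b k).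
  have := ind_sum (b (k + delta_mx 0 i)) (b k).
  rewrite (distrC (b (k + _))) => H1 H2.
  by apply: le_trans (lerD H2 H1) _; lra.
have [l lX] := exists_le_mean (ltn0Sn _ : (0 < M)%N) cX.
exists (t l); first exact: t13.
(* As [tau M = 1/3], the chosen level satisfies [hd (c l) / 3 <= V0 + V0 / 3]. *)
have cl : hd * c l <= 4 * V0.
  have : hd * (c l * M%:R) * tau <= V0 + hd * tau * J.
    move: lX; rewrite ler_pdivlMr ?mulr_gt0//.
    by apply: le_trans; rewrite le_eqVlt; apply/orP; left; apply/eqP; ring.
  have : tau * (hd * J) <= tau * (V0 * M%:R) by rewrite ler_pM2l.
  have E1 : hd * (c l * M%:R) * tau * 3 = hd * c l.
    transitivity (hd * c l * (3 * (tau * M%:R))); first ring.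
    by rewrite tauM mulr1.
  have E2 : tau * (V0 * M%:R) * 3 = V0.
    transitivity (V0 * (3 * (tau * M%:R))); first ring.
    by rewrite tauM mulr1.
  move: E1 E2; move: (hd * (c l * M%:R) * tau) (tau * (V0 * M%:R)) => u w.
  have -> : hd * tau * J = tau * (hd * J) by ring.
  move: (tau * (hd * J)) (hd * c l) => p q.
  by move=> *; lra.
apply: le_trans (figure_perimeter_le _ h0) _; rewrite lee_fin.
have count_le i (z : 'rV[int]_d) :
    (count (fun k => k + z \notin superlevel B n (t l)) (superlevel B n (t l)))%:R <=
    \sum_(k <- grid d n) ind (b (k + z)) (b k) l.
  rewrite {2}/superlevel count_filter -sum1_count natr_sum big_mkcond/=.
  apply: ler_sum => k _; case: ifP => [/andP[kz tk]|_]; last by rewrite ler0n.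
  rewrite /ind (ltW tk) andbT (notin_superlevel Bu _ kz)//.
  by have /andP[+ _] := t13 l; apply: le_trans; lra.
have -> : 8 * d%:R * per B = h^-1 * (4 * V0).
  by rewrite /V0; field; rewrite lt0r_neq0.
rewrite ler_pdivlMl// (le_trans _ cl)//.
rewrite mulrA -exprS prednK//; apply: ler_wpM2l; first exact: ltW.
rewrite /c; apply: ler_sum => i _; rewrite big_split/=.
by apply: lerD; apply: count_le.
Qed.

End Threshold.

Section Closeness.
Context (R : realType) (d : nat).
Implicit Types (x v : 'rV[R]_d) (i j : 'I_d) (k : 'rV[int]_d) (h t : R).
Implicit Types (A B : set 'rV[R]_d) (S F : seq 'rV[int]_d).

Lemma le_vol A B : A `<=` B -> (leb B < +oo)%E -> vol A <= vol B.
Proof.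
move=> AB Bf; rewrite -lee_fin -!vol_fin//; first exact: le_leb.
by apply: le_lt_trans Bf; exact: le_leb.
Qed.

Lemma figure_inter0 h F S : 0 < h -> (forall k, k \in F -> k \notin S) ->
  leb (figure h F `&` figure h S) = 0%E.
Proof.
move=> h0 FS.
rewrite (_ : _ `&` _ = [set x | exists2 k, k \in F & (cell h k `&` figure h S) x]).
  by apply: leb_bigcup0 => k kF; apply: figure_cell_inter0 => //; exact: FS.
by apply/seteqP; split => x [] => [[k kF kx] Sx|k kF [kx Sx]]; [exists k|split => //; exists k].
Qed.

(** A Markov inequality, cell by cell. It is used with [c = 3], both for [B] and for the part of a
    reference figure outside [B]. *)
Lemma leb_figure_le h S (c : R) A : 0 < h -> 0 <= c -> lmeasurable A -> (leb A < +oo)%E ->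
  uniq S -> (forall k, k \in S -> h ^+ d <= c * vol (A `&` cell h k)) ->
  (leb (figure h S) <= (c * vol (A `&` figure h S))%:E)%E.
Proof.
move=> h0 c0 mA Af uS H; rewrite vol_setI_figure//.
apply: le_trans (leb_bigcup_le _ _) _.
apply: (@le_trans _ _ (\sum_(k <- S) (h ^+ d)%:E)%E).
  by apply: lee_sum => k _; apply: leb_cell_le; exact: ltW.
rewrite sumEFin lee_fin mulr_sumr big_seq [leRHS]big_seq.
by apply: ler_sum => k; exact: H.
Qed.

Lemma vol_superlevel_le B n t : lmeasurable B -> B `<=` @unit_cube R d -> 1 / 3 <= t ->
  vol (figure (mesh R n) (superlevel B n t)) <= 3 * vol B.
Proof.
move=> mB Bu t3; have h0 := mesh_gt0 R n; have Bf := leb_unit_cube_fin Bu.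
rewrite -lee_fin -vol_fin ?leb_figure_fin ?(ltW h0)//.
apply: (@le_trans _ _ (3 * vol (B `&` figure (mesh R n) (superlevel B n t)))%:E).
  apply: leb_figure_le => //; first exact: superlevel_uniq.
  move=> k; rewrite mem_filter => /andP[/ltW tk _].
  have : 1 / 3 * mesh R n ^+ d <= t * mesh R n ^+ d by rewrite ler_wpM2r// exprn_ge0// ltW.
  by move: (mesh R n ^+ d) tk => p tk; move: (t * p) tk => q; lra.
by rewrite lee_fin ler_wpM2l// le_vol.
Qed.

(** A superlevel cell not in [S] has at least a third of its volume in [B], missed by [S]; a cell of
    [S] below the level has at least a third outside [B]. So each difference of the two figures is
    at most [3 e], and comparing with [B] through [S] adds [e] on each side. *)
Lemma superlevel_close B n t S (e : R) : (0 < d)%N -> lmeasurable B -> B `<=` @unit_cube R d ->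
  1 / 3 <= t <= 2 / 3 -> uniq S ->
  (leb (B `\` figure (mesh R n) S) <= e%:E)%E ->
  (leb (figure (mesh R n) S `\` B) <= e%:E)%E ->
  (leb (figure (mesh R n) (superlevel B n t) `+` B) <= (8 * e)%:E)%E.
Proof.
move=> d0 mB Bu /andP[t1 t2] uS BS SB.
have h0 := mesh_gt0 R n; have Bf := leb_unit_cube_fin Bu.
set h := mesh R n in h0 BS SB *; set F := superlevel B n t.
have FS : (leb (figure h F `\` figure h S) <= (3 * e)%:E)%E.
  pose F' := [seq k <- F | k \notin S].
  have F'B : vol (B `&` figure h F') <= e.
    rewrite -lee_fin -vol_fin; last by apply: le_lt_trans Bf; apply: le_leb => x [].
    (* Cells of [F'] are not in [S], so they meet [figure h S] in a null set only. *)
    apply: le_trans BS; rewrite -[leRHS]adde0 -(@figure_inter0 h F' S h0); last first.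
      by move=> k; rewrite mem_filter => /andP[].
    apply: le_trans (lebU_le _ _); apply: le_leb => x [Bx Fx].
    have [Sx|Sx] := pselect (figure h S x); [by right|by left].
  apply: (@le_trans _ _ (3 * vol (B `&` figure h F'))%:E); last first.
    by rewrite lee_fin ler_wpM2l.
  apply: (@le_trans _ _ (leb (figure h F'))).
    apply: le_leb => x [[k kF kx] nSx]; exists k => //; rewrite mem_filter kF andbT.
    by apply/negP => kS; apply: nSx; exists k.
  apply: leb_figure_le => //; first by rewrite filter_uniq// superlevel_uniq.
  move=> k; rewrite !mem_filter => /and3P[_ /ltW tk _].
  have : 1 / 3 * h ^+ d <= t * h ^+ d by rewrite ler_wpM2r// exprn_ge0// ltW.
  by rewrite -/h in tk; move: (h ^+ d) tk => p tk; move: (t * p) tk => q; lra.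
have SF : (leb (figure h S `\` figure h F) <= (3 * e)%:E)%E.
  pose S' := [seq k <- S | k \notin F]; pose A := figure h S `\` B.
  have mA : lmeasurable A by apply: lmeasurableD => //; exact: lmeasurable_figure.
  have Af : (leb A < +oo)%E by apply: le_lt_trans SB _; exact: ltry.
  have AS' : vol (A `&` figure h S') <= e.
    rewrite -lee_fin -vol_fin; first by apply: le_trans SB; apply: le_leb => x [].
    by apply: le_lt_trans Af; apply: le_leb => x [].
  apply: (@le_trans _ _ (3 * vol (A `&` figure h S'))%:E); last first.
    by rewrite lee_fin ler_wpM2l.
  apply: (@le_trans _ _ (leb (figure h S'))).
    apply: le_leb => x [[k kS kx] nFx]; exists k => //; rewrite mem_filter kS andbT.
    by apply/negP => kF; apply: nFx; exists k.
  apply: leb_figure_le => //; first by rewrite filter_uniq.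
  move=> k; rewrite mem_filter => /andP[kF kS].
  have tk : vol (B `&` cell h k) <= t * h ^+ d.
    by apply: notin_superlevel kF => //; lra.
  (* As [k] is in [S], the part of the cell outside [B] is its part in [A]. *)
  have : h ^+ d = vol (B `&` cell h k) + vol (A `&` cell h k).
    have cf : (leb (cell h k) < +oo)%E by rewrite leb_cell ?ltry.
    have If C : (leb (C `&` cell h k) < +oo)%E by apply: le_lt_trans cf; apply: le_leb => x [].
    apply: EFin_inj; rewrite EFinD -!vol_fin// -(leb_cell k d0 h0).
    rewrite (leb_setIC _ mB) setIC; congr (_ + leb _)%E.
    apply/seteqP; split => x; last by move=> [[_ nB] kx].
    by move=> [kx nBx]; split => //; split => //; exists k.
  have : t * h ^+ d <= 2 / 3 * h ^+ d by rewrite ler_wpM2r// exprn_ge0// ltW.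
  by move: (h ^+ d) tk => p tk; move: (t * p) tk => q; lra.
rewrite /setY (_ : 8 * e = (3 * e + e) + (e + 3 * e)); last by ring.
rewrite EFinD; apply: le_trans (lebU_le _ _) _; apply: leeD.
- rewrite EFinD; apply: le_trans (leeD FS SB); apply: le_trans (lebU_le _ _).
  apply: le_leb => x [Fx nBx].
  have [Sx|Sx] := pselect (figure h S x); [by right|by left].
- rewrite EFinD; apply: le_trans (leeD BS SF); apply: le_trans (lebU_le _ _).
  apply: le_leb => x [Bx nFx].
  have [Sx|Sx] := pselect (figure h S x); [by right|by left].
Qed.

Lemma bv_approx_figures B : (0 < d)%N -> lmeasurable B -> B `<=` @unit_cube R d ->
  (perimeter B < +oo)%E -> 0 < per B ->
  exists S : nat -> seq 'rV[int]_d, [/\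
    forall n, uniq (S n) /\ {subset S n <= grid d n},
    forall n, (perimeter (figure (mesh R n) (S n)) <= (8 * d%:R * per B)%:E)%E,
    forall n, vol (figure (mesh R n) (S n)) <= 3 * vol B &
    leb (figure (mesh R n) (S n) `+` B) @[n --> \oo] --> 0%E].
Proof.
move=> d0 mB Bu Bp P0.
have /choice[t tP] : forall n, exists t, 1 / 3 <= t <= 2 / 3 /\
    (perimeter (figure (mesh R n) (superlevel B n t)) <= (8 * d%:R * per B)%:E)%E.
  by move=> n; have [t] := exists_threshold n d0 mB Bu Bp P0; exists t.
exists (fun n => superlevel B n (t n)); split => [n|n|n|].
- by split; [exact: superlevel_uniq|exact: superlevel_sub].
- exact: (tP n).2.
- by apply: vol_superlevel_le => //; have [/andP[]] := tP n.
apply/fine_cvgP; split; last first.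
  apply/cvgrPdist_le => e e0.
  have e8 : 0 < e / 8 by rewrite divr_gt0.
  have [N HN] := approx_figure mB Bu e8.
  exists N => // n /= /HN[S [uS _ BS SB]].
  have H := superlevel_close d0 mB Bu (tP n).1 uS BS SB.
  rewrite sub0r normrN ger0_norm ?fine_ge0 ?leb_ge0//.
  rewrite -lee_fin fineK; last first.
    by rewrite ge0_fin_numE ?leb_ge0// (le_lt_trans H)// ltry.
  by apply: le_trans H _; rewrite lee_fin mulrCA divff// mulr1.
apply: nearW => n; rewrite ge0_fin_numE ?leb_ge0//.
apply: le_lt_trans (lebU_le _ _) _; apply: lte_add_pinfty.
  apply: le_lt_trans (leb_figure_fin (superlevel B n (t n)) (ltW (mesh_gt0 R n))).
  by apply: le_leb => x [].
by apply: le_lt_trans (leb_unit_cube_fin Bu); apply: le_leb => x [].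
Qed.

End Closeness.

(** * Charges on dyadic figures *)

Section Refinement.
Context (R : realType) (d : nat).
Implicit Types (x v : 'rV[R]_d) (i j : 'I_d) (k l : 'rV[int]_d) (h t : R).
Implicit Types (A B : set 'rV[R]_d) (S F : seq 'rV[int]_d).

Definition parent k : 'rV[int]_d := \row_i (k 0%R i %/ 2)%Z.

Definition children n k : seq 'rV[int]_d := [seq l <- grid d n.+1 | parent l == k].

Lemma children_uniq n k : uniq (children n k).
Proof. by rewrite filter_uniq// grid_uniq. Qed.

Lemma children_sub n k : {subset children n k <= grid d n.+1}.
Proof. by move=> l; rewrite mem_filter => /andP[]. Qed.

Lemma parent_grid n k : k \in grid d n.+1 -> parent k \in grid d n.
Proof.
move=> /mem_gridP kn; apply/mem_gridP => i; rewrite mxE.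
by have := kn i; rewrite expnS; lia.
Qed.

Lemma mem_children n k l : k \in grid d n ->
  (forall i, (l 0%R i %/ 2)%Z = k 0 i) -> l \in children n k.
Proof.
move=> /mem_gridP kn lk; rewrite mem_filter; apply/andP; split.
  by apply/eqP/rowP => i; rewrite mxE lk.
apply/mem_gridP => i; have := kn i; rewrite -lk expnS; lia.
Qed.

Lemma cell_children n k : k \in grid d n ->
  cell (mesh R n) k = figure (mesh R n.+1) (children n k).
Proof.
move=> kn; have h0 := mesh_gt0 R n.+1; apply/seteqP; split => x.
  move=> kx; set h := mesh R n.+1 in h0 *.
  pose l : 'rV[int]_d := \row_i (2 * k 0 i + (if x 0 i <= (2 * k 0 i + 1)%:~R * h then 0 else 1)).
  exists l.
    by apply: mem_children => // i; rewrite mxE; case: ifP => _; lia.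
  move=> i; have := kx i; rewrite mxE (meshS R n) -/h.
  have [H|H] := leP (x 0 i) ((2 * k 0 i + 1)%:~R * h); move: H;
    rewrite !intrD !intrM; move: ((k 0 i)%:~R : R) => u H /andP[? ?]; apply/andP; split; lra.
move=> [l lk lx] i; move: lk; rewrite mem_filter => /andP[/eqP <- _].
rewrite mxE (meshS R n); have := lx i; set h := mesh R n.+1 in h0 *.
have [->|->] : l 0 i = 2 * (l 0%R i %/ 2)%Z \/ l 0 i = 2 * (l 0%R i %/ 2)%Z + 1 by lia.
  rewrite mulKz// !intrD intrM; move: ((l 0%R i %/ 2)%Z%:~R : R) => u /andP[? ?]; apply/andP; split; lra.
rewrite !intrD intrM.
rewrite (_ : ((2 * (l 0%R i %/ 2)%Z + 1)%R %/ 2)%Z = (l 0%R i %/ 2)%Z); last by lia.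
move: ((l 0%R i %/ 2)%Z%:~R : R) => u /andP[? ?]; apply/andP; split; lra.
Qed.

Lemma sum_grid_children n (G : 'rV[int]_d -> R) :
  \sum_(l <- grid d n.+1) G l = \sum_(k <- grid d n) \sum_(l <- children n k) G l.
Proof.
under [RHS]eq_bigr do rewrite big_filter big_mkcond.
rewrite exchange_big/=; apply: eq_big_seq => l ln.
rewrite (bigD1_seq (parent l))/= ?grid_uniq ?parent_grid// eqxx big1 ?addr0// => k kl.
by rewrite eq_sym (negbTE kl).
Qed.

(* Joins two children of a cell by changing the coordinates one at a time. *)
Lemma children_path_le n k (a : 'rV[int]_d -> R) l l' : k \in grid d n ->
  l \in children n k -> l' \in children n k ->
  `|a l' - a l| <= \sum_i \sum_(j <- children n k) `|a (j + delta_mx 0 i) - a j|.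
Proof.
move=> kn lk l'k.
pose q (m : nat) : 'rV[int]_d := \row_i (if (i < m)%N then l' 0 i else l 0 i).
have par (j : 'rV[int]_d) : j \in children n k -> forall i, (j 0%R i %/ 2)%Z = k 0 i.
  by rewrite mem_filter => /andP[/eqP <- _] i; rewrite mxE.
have qk m : q m \in children n k.
  by apply: mem_children => // i; rewrite mxE; case: ifP => _; exact: par.
have q0 : q 0%N = l by apply/rowP => i; rewrite mxE.
have qd : q d = l' by apply/rowP => i; rewrite mxE ltn_ord.
have -> : a l' - a l = \sum_(i < d) (a (q i.+1) - a (q i)).
  by rewrite -(big_mkord xpredT (fun m : nat => a (q m.+1) - a (q m))) (@telescope_sumr _ _ _ (fun m : nat => a (q m)))// q0 qd.
apply: le_trans (ler_norm_sum _ _ _) _; apply: ler_sum => i _.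
have single (j : 'rV[int]_d) : j \in children n k -> `|a (j + delta_mx 0 i) - a j| <=
    \sum_(j <- children n k) `|a (j + delta_mx 0 i) - a j|.
  move=> jk; rewrite (bigD1_seq j)/= ?children_uniq// lerDl.
  by apply: sumr_ge0.
have li := par _ lk i; have l'i := par _ l'k i.
(* Both coordinates have the same integer half, so they differ by at most 1. *)
have [E|[E|E]] : l' 0 i = l 0 i \/ (l' 0 i = l 0 i + 1 \/ l 0 i = l' 0 i + 1) by lia.
- rewrite (_ : q i.+1 = q i) ?subrr ?normr0; first by apply: sumr_ge0.
  apply/rowP => u; rewrite !mxE ltnS.
  by case: (ltngtP u i) => // /val_inj ->.
- rewrite (_ : q i.+1 = q i + delta_mx 0 i); first exact: single.
  apply/rowP => u; rewrite !mxE ltnS eqxx/=.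
  case: (ltngtP u i) => [ui|ui|/val_inj ->]; rewrite ?eqxx//.
    by rewrite -val_eqE ltn_eqF// addr0.
  by rewrite -val_eqE gtn_eqF// addr0.
- rewrite distrC (_ : q i = q i.+1 + delta_mx 0 i); first exact: single.
  apply/rowP => u; rewrite !mxE ltnS eqxx/=.
  case: (ltngtP u i) => [ui|ui|/val_inj ->]; rewrite ?eqxx//.
    by rewrite -val_eqE ltn_eqF// addr0.
  by rewrite -val_eqE gtn_eqF// addr0.
Qed.

Definition density A n k : R := vol (A `&` cell (mesh R n) k) / mesh R n ^+ d.

Lemma vol_cell_children A n k : lmeasurable A -> (leb A < +oo)%E -> k \in grid d n ->
  vol (A `&` cell (mesh R n) k) = \sum_(l <- children n k) vol (A `&` cell (mesh R n.+1) l).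
Proof.
move=> mA Af kn; rewrite cell_children// vol_setI_figure//.
- exact: mesh_gt0.
- exact: children_uniq.
Qed.

Lemma vol_cell n k : (0 < d)%N -> vol (cell (mesh R n) k) = mesh R n ^+ d.
Proof. by move=> d0; rewrite /vol leb_cell//; exact: mesh_gt0. Qed.

(** Comparing volumes gives the count without an explicit enumeration of the children. *)
Lemma size_children n k : (0 < d)%N -> k \in grid d n ->
  (size (children n k))%:R = 2 ^+ d :> R.
Proof.
move=> d0 kn; have h0 := mesh_gt0 R n.+1.
have := @vol_cell_children (cell (mesh R n) k) n k (lmeasurable_cell _ _) _ kn.
rewrite setIid vol_cell// leb_cell ?mesh_gt0// => /(_ (ltry _)).
rewrite (eq_big_seq (fun=> mesh R n.+1 ^+ d)); last first.
  move=> l lk; rewrite (_ : _ `&` _ = cell (mesh R n.+1) l) ?vol_cell//.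
  by apply/setIidPr; rewrite (cell_children kn) => x lx; exists l.
rewrite big_const_seq count_predT iter_addr_0 -[RHS]mulr_natl meshS exprMn.
by move/mulIf => <- //; rewrite expf_neq0// lt0r_neq0.
Qed.

Lemma density_children A n k : (0 < d)%N -> lmeasurable A -> (leb A < +oo)%E ->
  k \in grid d n -> 2 ^+ d * density A n k = \sum_(l <- children n k) density A n.+1 l.
Proof.
move=> d0 mA Af kn; rewrite /density vol_cell_children// -!mulr_suml (meshS R n) exprMn.
have h0 : mesh R n.+1 ^+ d != 0 by rewrite expf_neq0// lt0r_neq0// mesh_gt0.
by rewrite invfM mulrCA mulVKf// expf_neq0.
Qed.

(** The density of a cell is the mean over its [2^d] children, and any two children are joined by
    [children_path_le]. *)
Lemma density_oscillation A n k l : (0 < d)%N -> lmeasurable A -> (leb A < +oo)%E ->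
  k \in grid d n -> l \in children n k ->
  `|density A n k - density A n.+1 l| <=
  \sum_i \sum_(j <- children n k) `|density A n.+1 (j + delta_mx 0 i) - density A n.+1 j|.
Proof.
move=> d0 mA Af kn lk; set E := \sum_i _.
have d2 : 0 < 2 ^+ d :> R by rewrite exprn_gt0.
rewrite -(ler_pM2l d2) -{1}(gtr0_norm d2) -normrM mulrBr density_children//.
rewrite -(size_children d0 kn) !mulr_natl.
rewrite -!iter_addr_0 -!count_predT -!big_const_seq -sumrB.
apply: le_trans (ler_norm_sum _ _ _) _.
rewrite big_seq [leRHS]big_seq; apply: ler_sum => l' l'k.
exact: children_path_le.
Qed.

Lemma density_variation A n : lmeasurable A -> A `<=` @unit_cube R d ->
  (perimeter A < +oo)%E ->
  \sum_i \sum_(j <- grid d n) `|density A n (j + delta_mx 0 i) - density A n j| <=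
  d%:R * (mesh R n * per A / mesh R n ^+ d).
Proof.
move=> mA Au Ap; have h0 := mesh_gt0 R n.
rewrite mulr_natl -[X in _ *+ X]card_ord -sumr_const; apply: ler_sum => i _.
have hd : 0 < mesh R n ^+ d by rewrite exprn_gt0.
rewrite ler_pdivlMr// mulr_suml; apply: le_trans (grid_variation_le n i (delta_mx 0 i) mA Au Ap).
apply: ler_sum => k _; rewrite addrK distrC -[X in _ * X](gtr0_norm hd) -normrM.
by rewrite /density mulrBl !divfK// lt0r_neq0.
Qed.

End Refinement.

Section Charge.
Context (R : realType) (d : nat).
Implicit Types (x v : 'rV[R]_d) (i j : 'I_d) (k l : 'rV[int]_d) (h t : R).
Implicit Types (A B : set 'rV[R]_d) (S F : seq 'rV[int]_d).
Hypothesis d0 : (0 < d)%N.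

Lemma unit_cube_bounded : bounded_set (@unit_cube R d).
Proof.
exists 1; split => // M M1 x ux; rewrite /= [leLHS]/Num.Def.normr/= mx_normrE.
apply: bigmax_le => [|[a b] _ /=]; first by apply: le_trans (ltW M1).
rewrite (ord1 a); have /andP[x0 x1] := ux b; rewrite ger0_norm//.
by apply: le_trans x1 (ltW M1).
Qed.

Lemma figure_bv_cube n S : {subset S <= grid d n} -> bv_cube (figure (mesh R n) S).
Proof.
move=> Sn; have Su : figure (mesh R n) S `<=` @unit_cube R d.
  by move=> x [k kS]; apply: grid_cell_unit; exact: Sn.
split => //; split.
- have [M [Mr HM]] := unit_cube_bounded; exists M; split => // N MN x /Su ux.
  exact: HM MN x ux.
- exact: lmeasurable_figure.
- by apply: le_lt_trans (figure_perimeter_le S (mesh_gt0 R n)) _; exact: ltry.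
Qed.

Variables (gamma : R) (omega : set 'rV[R]_d -> R).
Hypothesis (Cw : charge_on_cube omega).

Let H : R := fine (holder_norm gamma omega).

Lemma charge_set0 : omega set0 = 0.
Proof.
have b0 : bv_cube (set0 : set 'rV[R]_d).
  by rewrite -(figure_nil d (mesh R 0)); exact: figure_bv_cube.
have := Cw.1 _ _ b0 b0; rewrite setI0 setU0 measure0 => /(_ erefl).
by move/eqP; rewrite -subr_eq0 opprD addrA subrr sub0r oppr_eq0 => /eqP.
Qed.

Lemma charge_figure n S : uniq S -> {subset S <= grid d n} ->
  omega (figure (mesh R n) S) = \sum_(k <- S) omega (cell (mesh R n) k).
Proof.
elim: S => [|k S IH] /=; first by rewrite figure_nil big_nil charge_set0.
move=> /andP[kS uS] Sn; rewrite big_cons figure_cons.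
have Sn' : {subset S <= grid d n} by move=> l lS; apply: Sn; rewrite inE lS orbT.
rewrite Cw.1 ?IH//.
- have -> : cell (mesh R n) k = figure (mesh R n) [:: k].
    by rewrite figure_cons figure_nil setU0.
  by apply: figure_bv_cube => l; rewrite inE => /eqP ->; apply: Sn; rewrite mem_head.
- exact: figure_bv_cube.
- by apply: figure_cell_inter0 => //; exact: mesh_gt0.
Qed.

Lemma cell_dyadic n k : k \in grid d n -> dyadic_cube (cell (mesh R n) k).
Proof.
move=> /mem_gridP kn; exists n, (fun i => absz (k 0 i)); split => [i|].
  by have := kn i; have := expn_gt0 2 n; lia.
apply/seteqP; split => x kx i; have := kx i; have /andP[k0 _] := kn i.
- have -> : (k 0 i)%:~R = (absz (k 0 i))%:R :> R by rewrite natr_absz ger0_norm.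
  have -> : (k 0 i + 1)%:~R = (absz (k 0 i)).+1%:R :> R.
    by rewrite intrD -natr1 natr_absz ger0_norm.
  by [].
- have -> : (k 0 i)%:~R = (absz (k 0 i))%:R :> R by rewrite natr_absz ger0_norm.
  have -> : (k 0 i + 1)%:~R = (absz (k 0 i)).+1%:R :> R.
    by rewrite intrD -natr1 natr_absz ger0_norm.
  by [].
Qed.

Lemma grid0_mem : (0 : 'rV[int]_d) \in grid d 0.
Proof. by apply/mem_gridP => i; rewrite mxE. Qed.

Lemma holder_norm_ge0 : (0 <= holder_norm gamma omega)%E.
Proof.
apply: (@le_trans _ _ (`|omega (cell (mesh R 0) 0)| / vol (cell (mesh R 0) 0) `^ gamma)%:E).
  by rewrite lee_fin divr_ge0// powR_ge0.
apply: ereal_sup_ubound; exists (cell (mesh R 0) 0) => //.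
exact/cell_dyadic/grid0_mem.
Qed.

Lemma holder_const_ge0 : 0 <= H.
Proof. exact/fine_ge0/holder_norm_ge0. Qed.

Hypothesis Hw : (holder_norm gamma omega < +oo)%E.

Lemma charge_cell_le n k : k \in grid d n ->
  `|omega (cell (mesh R n) k)| <= H * (mesh R n ^+ d) `^ gamma.
Proof.
move=> kn; have h0 := mesh_gt0 R n.
have hd : 0 < (mesh R n ^+ d) `^ gamma by rewrite powR_gt0// exprn_gt0.
rewrite -ler_pdivrMr// -(vol_cell R n k d0) -lee_fin /H fineK; last first.
  by rewrite ge0_fin_numE// holder_norm_ge0.
apply: ereal_sup_ubound; exists (cell (mesh R n) k) => //.
exact: cell_dyadic.
Qed.

Definition charge_step A n : R := \sum_(k <- grid d n) density A n k * omega (cell (mesh R n) k).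

Lemma charge_cell_children n k : k \in grid d n ->
  omega (cell (mesh R n) k) = \sum_(l <- children n k) omega (cell (mesh R n.+1) l).
Proof.
move=> kn; rewrite cell_children// charge_figure//; first exact: children_uniq.
exact: children_sub.
Qed.

(** By additivity of [omega] both sums can be written over the children. The factor [2^d] appears
    because each child is charged the whole variation among the children of its parent. *)
Lemma charge_stepS A n : lmeasurable A -> A `<=` @unit_cube R d -> (perimeter A < +oo)%E ->
  `|charge_step A n - charge_step A n.+1| <=
  H * (mesh R n.+1 ^+ d) `^ gamma * (2 ^+ d * (d%:R * (mesh R n.+1 * per A / mesh R n.+1 ^+ d))).
Proof.
move=> mA Au Ap; have Af := leb_unit_cube_fin Au.
set c := H * _; have c0 : 0 <= c by rewrite mulr_ge0 ?holder_const_ge0// powR_ge0.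
have -> : charge_step A n - charge_step A n.+1 =
    \sum_(k <- grid d n) \sum_(l <- children n k)
      (density A n k - density A n.+1 l) * omega (cell (mesh R n.+1) l).
  rewrite /charge_step (sum_grid_children n) -sumrB; apply: eq_big_seq => k kn.
  rewrite charge_cell_children// mulr_sumr -sumrB.
  by apply: eq_bigr => l _; rewrite mulrBl.
apply: le_trans (ler_norm_sum _ _ _) _.
pose E k := \sum_i \sum_(j <- children n k) `|density A n.+1 (j + delta_mx 0 i) - density A n.+1 j|.
apply: (@le_trans _ _ (\sum_(k <- grid d n) c * (2 ^+ d * E k))).
  rewrite big_seq [leRHS]big_seq; apply: ler_sum => k kn.
  apply: le_trans (ler_norm_sum _ _ _) _.
  rewrite -(size_children R d0 kn) mulr_natl mulrnAr -iter_addr_0 -count_predT -big_const_seq.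
  rewrite big_seq [leRHS]big_seq; apply: ler_sum => l lk.
  rewrite normrM mulrC; apply: ler_pM => //.
    by apply: charge_cell_le; exact: children_sub lk.
  exact: density_oscillation.
rewrite -mulr_sumr ler_wpM2l// -mulr_sumr ler_wpM2l ?exprn_ge0//.
apply: le_trans (density_variation n.+1 mA Au Ap).
rewrite /E exchange_big/=; apply: ler_sum => i _.
by rewrite (sum_grid_children n).
Qed.

(** At its own mesh a figure has density 0 or 1 in every cell. *)
Lemma charge_step_figure m S : uniq S -> {subset S <= grid d m} ->
  charge_step (figure (mesh R m) S) m = omega (figure (mesh R m) S).
Proof.
move=> uS Sm; rewrite charge_figure//; have h0 := mesh_gt0 R m.
have -> : \sum_(k <- S) omega (cell (mesh R m) k) =
    \sum_(k <- grid d m | k \in S) omega (cell (mesh R m) k).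
  rewrite -[RHS]big_filter; apply: perm_big; apply: uniq_perm => //.
    by rewrite filter_uniq// grid_uniq.
  by move=> k; rewrite mem_filter; apply/idP/andP => [kS|[]//]; split => //; exact: Sm.
rewrite big_mkcond; apply: eq_bigr => k _; rewrite /density; case: ifPn => kS.
  rewrite (_ : _ `&` _ = cell (mesh R m) k) ?vol_cell ?divff ?mul1r//.
    by rewrite expf_neq0// lt0r_neq0.
  by apply/setIidPr => x kx; exists k.
by rewrite setIC /vol figure_cell_inter0// mul0r mul0r.
Qed.

Lemma charge_step_le A n : lmeasurable A -> A `<=` @unit_cube R d ->
  `|charge_step A n| <= H * (mesh R n ^+ d) `^ gamma * (vol A / mesh R n ^+ d).
Proof.
move=> mA Au; apply: le_trans (ler_norm_sum _ _ _) _.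
have h0 : 0 < mesh R n ^+ d by rewrite exprn_gt0// mesh_gt0.
have -> : vol A = \sum_(k <- grid d n) vol (A `&` cell (mesh R n) k).
  rewrite -vol_setI_figure ?grid_uniq ?mesh_gt0 ?leb_unit_cube_fin//.
  congr vol; apply/esym/setIidPl => x /Au ux.
  by have [k kn kx] := unit_cube_grid n ux; exists k.
rewrite mulr_suml mulr_sumr big_seq [leRHS]big_seq; apply: ler_sum => k kn.
rewrite normrM mulrC; apply: ler_pM => //; first exact: charge_cell_le.
by rewrite ger0_norm// divr_ge0 ?vol_ge0// ltW.
Qed.

End Charge.

(** * Exponents and the final estimate *)

Section Exponents.
Context (R : realType) (d : nat) (gamma : R).
Hypotheses (d0 : (0 < d)%N) (hg : (d%:R - 1) / d%:R < gamma) (hg1 : gamma <= 1).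

(** The power of the mesh in the successive differences; it is positive exactly when
    [gamma > (d - 1) / d]. Its complement to 1, [holder_coexp], is the power lost in the direct
    bound at a single mesh. *)
Definition holder_exp : R := d%:R * gamma - (d%:R - 1).

Definition holder_coexp : R := d%:R * (1 - gamma).

Let d0' : 0 < d%:R :> R. Proof. by rewrite ltr0n. Qed.

Lemma holder_exp_gt0 : 0 < holder_exp.
Proof. by rewrite subr_gt0 mulrC -ltr_pdivrMr. Qed.

Lemma holder_coexp_ge0 : 0 <= holder_coexp.
Proof. by rewrite mulr_ge0 ?subr_ge0// ltW. Qed.

Lemma holder_expE : holder_exp = 1 - holder_coexp.
Proof. by rewrite /holder_exp /holder_coexp; ring. Qed.

Lemma powR_exp_ln (x a : R) : 0 < x -> x `^ a = expR (a * ln x).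
Proof. by move=> x0; rewrite /powR gt_eqF. Qed.

Lemma expr_expR (x : R) : 0 < x -> x ^+ d = expR (d%:R * ln x).
Proof. by move=> x0; rewrite -powR_mulrn ?ltW// powR_exp_ln. Qed.

Lemma powR_cell (h : R) : 0 < h -> (h ^+ d) `^ gamma / h ^+ d = h `^ (- holder_coexp).
Proof.
move=> h0; rewrite powR_exp_ln ?exprn_gt0// expr_expR// expRK powR_exp_ln// -expRN -expRD.
by congr expR; rewrite /holder_coexp; ring.
Qed.

Lemma powR_cell_face (h : R) : 0 < h ->
  (h ^+ d) `^ gamma * (h / h ^+ d) = h `^ holder_exp.
Proof.
move=> h0; rewrite mulrCA powR_cell// -{1}(lnK h0) !powR_exp_ln// -expRD.
by congr expR; rewrite holder_expE; ring.
Qed.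

Definition holder_ratio : R := 2^-1 `^ holder_exp.

Lemma holder_ratio_ge0 : 0 <= holder_ratio.
Proof. exact: powR_ge0. Qed.

Lemma holder_ratio_lt1 : holder_ratio < 1.
Proof.
apply: (@lt_le_trans _ _ (1 `^ holder_exp)); last by rewrite powR1.
apply: gt0_ltr_powR.
- exact: holder_exp_gt0.
- by rewrite nnegrE invr_ge0.
- by rewrite nnegrE.
- by rewrite invf_lt1// ltr1n.
Qed.

Lemma mesh_powR n : mesh R n `^ holder_exp = holder_ratio ^+ n.
Proof.
rewrite /mesh -exprVn -(@powR_mulrn _ 2^-1) ?invr_ge0// powRAC powR_mulrn//.
Qed.

(** The ratio in terms of [|B| / ||B||], the length to which the mesh will be matched. *)
Lemma isop_ratioE (B : set 'rV[R]_d) : 0 < vol B -> 0 < per B ->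
  isop_ratio gamma B = per B * (vol B / per B) `^ holder_exp.
Proof.
move=> v0 p0; rewrite /isop_ratio gt_eqF// /isop.
have i0 : 0 < vol B `^ ((d%:R - 1) / d%:R) / per B by rewrite divr_gt0// powR_gt0.
have lnI : ln (vol B `^ ((d%:R - 1) / d%:R) / per B) =
    (d%:R - 1) / d%:R * ln (vol B) - ln (per B).
  by rewrite ln_div ?posrE ?powR_gt0// ln_powR.
rewrite -[X in _ = X * _](lnK p0) [X in X / _]powR_exp_ln// powR_exp_ln// lnI.
rewrite powR_exp_ln ?divr_gt0// ln_div ?posrE// -expRN -!expRD.
by congr expR; rewrite /holder_exp; field; rewrite lt0r_neq0.
Qed.

(** Step back from the first mesh below [rho]; this is possible because the coarsest mesh, 1, is not
    below [rho]. *)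
Lemma exists_mesh (rho : R) : 0 < rho -> rho <= 1 ->
  exists n, rho <= mesh R n /\ mesh R n < 2 * rho.
Proof.
move=> r0 r1.
have ex : exists n, mesh R n < rho.
  have /cvgrPdist_lt/(_ _ r0)[n _ /(_ n (leqnn _))] := @mesh_cvg0 R.
  by rewrite /= sub0r normrN gtr0_norm ?mesh_gt0// => H; exists n.
have [n nr nmin] := ex_minnP ex.
case: n nr nmin => [|n] nr nmin; first by move: nr; rewrite /mesh expr0 invr1 ltNge r1.
exists n; split; last by rewrite meshS ltr_pM2l.
by rewrite leNgt; apply/negP => /nmin; rewrite ltnn.
Qed.

End Exponents.

Section Main.
Context (R : realType) (d : nat) (gamma : R).
Hypotheses (d0 : (0 < d)%N) (hg : (d%:R - 1) / d%:R < gamma) (hg1 : gamma <= 1).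
Variable (omega : set 'rV[R]_d -> R).
Hypothesis sw : sch gamma omega.

Let H : R := fine (holder_norm gamma omega).
Let q := holder_ratio d gamma.
Let s := holder_coexp d gamma.
Let K : R := 2 ^+ d * d%:R.

Let K_ge0 : 0 <= K.
Proof. by rewrite mulr_ge0 ?exprn_ge0. Qed.

Let Hn_ge0 : 0 <= H.
Proof. exact/fine_ge0/holder_norm_ge0. Qed.

Lemma charge_step_bound A n j : lmeasurable A -> A `<=` @unit_cube R d ->
  (perimeter A < +oo)%E ->
  `|charge_step omega A (n + j)| <= `|charge_step omega A n| +
    H * K * per A * ((q ^+ n - q ^+ (n + j)) / (1 - q)).
Proof.
move=> mA Au Ap.
have q1 : 1 - q != 0 by rewrite subr_eq0 gt_eqF// holder_ratio_lt1.
elim: j => [|j IH]; first by rewrite addn0 subrr mul0r mulr0 addr0.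
rewrite addnS; set m := (n + j)%N in IH *.
have := charge_stepS d0 sw.1 sw.2 m mA Au Ap.
rewrite -/H; have -> : H * (mesh R m.+1 ^+ d) `^ gamma *
    (2 ^+ d * (d%:R * (mesh R m.+1 * per A / mesh R m.+1 ^+ d))) =
    H * K * per A * ((mesh R m.+1 ^+ d) `^ gamma * (mesh R m.+1 / mesh R m.+1 ^+ d)).
  by rewrite /K; ring.
rewrite powR_cell_face ?mesh_gt0// mesh_powR// -/q => st.
have qE : (q ^+ n - q ^+ m.+1) / (1 - q) = (q ^+ n - q ^+ m) / (1 - q) + q ^+ m.
  by rewrite exprS; field.
(* The step from [m] to [m + 1] contributes [q^(m+1)]; weakening it to [q^m] fits the closed form of
   the partial sums. *)
have qm : q ^+ m.+1 <= q ^+ m.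
  by rewrite exprS ler_piMl ?exprn_ge0 ?holder_ratio_ge0// ltW// holder_ratio_lt1.
rewrite qE mulrDr addrA.
have P0 : 0 <= H * K * per A.
  by rewrite !mulr_ge0// fine_ge0// perimeter_ge0.
have := ler_wpM2l P0 qm.
move: (H * K * per A) IH st => c IH st cq.
have := ler_distD 0 (charge_step omega A m) (charge_step omega A m.+1).
have := ler_distD (charge_step omega A m) 0 (charge_step omega A m.+1).
by rewrite !sub0r !normrN !subr0; lra.
Qed.

(** The fine mesh [m] enters only through the volume and perimeter of the figure, so the bound
    survives [m -> oo], and the coarse mesh [n] can be chosen last. *)
Lemma charge_figure_bound n m S : (n <= m)%N -> uniq S -> {subset S <= grid d m} ->
  `|omega (figure (mesh R m) S)| <= H * (mesh R n `^ (- s) * vol (figure (mesh R m) S) +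
    K * per (figure (mesh R m) S) * (mesh R n `^ holder_exp d gamma / (1 - q))).
Proof.
move=> nm uS Sm; have [[_ mA Ap] Au] := @figure_bv_cube R d m S Sm.
set A := figure _ _ in mA Ap Au *.
have q0 : 0 <= q := holder_ratio_ge0 _ _.
have q1 : 0 < 1 - q by rewrite subr_gt0 holder_ratio_lt1.
have := charge_step_bound n (m - n) mA Au Ap; rewrite subnKC// charge_step_figure//; last exact: sw.1.
move=> /le_trans; apply; rewrite mulrDr; apply: lerD.
  apply: le_trans (charge_step_le d0 sw.2 n mA Au) _.
  rewrite -/H -(powR_cell d gamma (mesh_gt0 R n)) le_eqVlt; apply/orP; left; apply/eqP; ring.
rewrite [leRHS]mulrA (mulrA H K).
rewrite ler_wpM2l//.
  by rewrite !mulr_ge0// fine_ge0// perimeter_ge0.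
rewrite mesh_powR ler_wpM2r ?invr_ge0 ?(ltW q1)//.
by rewrite lerBlDr lerDl exprn_ge0.
Qed.

Lemma charge_bound B n : bv_cube B -> 0 < per B ->
  `|omega B| <= H * (mesh R n `^ (- s) * (3 * vol B) +
    K * (8 * d%:R * per B) * (mesh R n `^ holder_exp d gamma / (1 - q))).
Proof.
move=> bB P0; have [[_ mB Bp] Bu] := bB.
have [S [Sg Sp Sv Sc]] := bv_approx_figures d0 mB Bu Bp P0.
have cw : omega (figure (mesh R m) (S m)) @[m --> \oo] --> omega B.
  apply: sw.1.2 => //; first by move=> m; apply: figure_bv_cube => //; exact: (Sg m).2.
  split => //; apply: le_lt_trans (ltry (8 * d%:R * per B)).
  by apply: ge_ereal_sup => _ [m _ <-]; exact: Sp.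
apply: (cvgr_to_le (cvg_norm cw)); near=> m.
have nm : (n <= m)%N by near: m; exact: nbhs_infty_ge.
apply: le_trans (charge_figure_bound nm (Sg m).1 (Sg m).2) _.
have q1 : 0 < 1 - q by rewrite subr_gt0 holder_ratio_lt1.
rewrite ler_wpM2l//; apply: lerD.
  by rewrite ler_wpM2l ?powR_ge0.
rewrite ler_wpM2r ?mulr_ge0 ?powR_ge0 ?invr_ge0 ?(ltW q1)//.
rewrite ler_wpM2l//.
have mf := lmeasurable_figure (mesh R m) (S m).
rewrite -lee_fin /per fineK ?Sp// ge0_fin_numE ?perimeter_ge0//.
by apply: le_lt_trans (Sp m) _; exact: ltry.
Unshelve. all: by end_near. Qed.

(** A negligible set meets itself in a null set, so additivity gives
    [omega B = omega B + omega B]. *)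
Lemma charge_null B : bv_cube B -> vol B = 0 -> omega B = 0.
Proof.
move=> bB vB; have [[_ mB _] Bu] := bB.
have := sw.1.1 _ _ bB bB; rewrite setIid setUid vol_fin ?leb_unit_cube_fin// vB => /(_ erefl).
by move/eqP; rewrite -subr_eq0 opprD addrA subrr sub0r oppr_eq0 => /eqP.
Qed.

Lemma charge_isop_bound B : bv_cube B ->
  `|omega B| <= (3 + 16 * d%:R * K / (1 - q)) * H * isop_ratio gamma B.
Proof.
move=> bB; have [[_ mB Bp] Bu] := bB.
have q1 : 0 < 1 - q by rewrite subr_gt0 holder_ratio_lt1.
have [v0|v0] := eqVneq (vol B) 0.
  rewrite charge_null// normr0 /isop_ratio v0 eqxx !mulr_ge0 ?powR_ge0//.
  by rewrite addr_ge0// !mulr_ge0 ?invr_ge0 ?(ltW q1).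
have {}v0 : 0 < vol B by rewrite lt0r v0 vol_ge0.
have vP := vol_le_per d0 mB Bu Bp.
have P0 : 0 < per B by exact: lt_le_trans vP.
rewrite isop_ratioE//; set rho := vol B / per B.
have r0 : 0 < rho by rewrite divr_gt0.
have r1 : rho <= 1 by rewrite ler_pdivrMr// mul1r.
(* The lower bound on the mesh controls its negative power, the upper bound its positive power. *)
have [n [rn nr]] := exists_mesh r0 r1.
apply: le_trans (charge_bound n bB P0) _.
have -> : (3 + 16 * d%:R * K / (1 - q)) * H * (per B * rho `^ holder_exp d gamma) =
   H * (3 * (per B * rho `^ holder_exp d gamma) +
   K * (8 * d%:R * per B) * (2 * rho `^ holder_exp d gamma / (1 - q))).
  by field; rewrite lt0r_neq0.
have e0 := holder_exp_gt0 d0 hg.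
rewrite ler_wpM2l//; apply: lerD.
  have -> : per B * rho `^ holder_exp d gamma = rho `^ (- s) * vol B.
    have -> : vol B = rho * per B by rewrite divfK// lt0r_neq0.
    rewrite holder_expE -/s powRD ?powRr1 ?(ltW r0)//; last by rewrite lt0r_neq0 ?implybT.
    by ring.
  rewrite mulrCA; apply: ler_wpM2l => //; rewrite ler_wpM2r ?(ltW v0)//.
  rewrite !powRN lef_pV2 ?posrE ?powR_gt0 ?mesh_gt0//.
  by apply: ge0_ler_powR => //; rewrite ?holder_coexp_ge0// nnegrE ltW// mesh_gt0.
apply: ler_wpM2l; first by rewrite !mulr_ge0// ltW.
rewrite ler_wpM2r ?invr_ge0 ?(ltW q1)//.
(* The factor 2 turns the 8 of [charge_bound] into 16; it suffices because [2^holder_exp <= 2], the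
   exponent being at most 1. *)
apply: (@le_trans _ _ ((2 * rho) `^ holder_exp d gamma)).
  apply: ge0_ler_powR; [exact: ltW| | |exact: ltW]; rewrite nnegrE ltW//.
    exact: mesh_gt0.
  by rewrite mulr_gt0.
rewrite powRM ?(ltW r0)// ler_wpM2r ?powR_ge0//.
apply: ler1_powR; first by rewrite ler1n.
by rewrite holder_expE lerBlDr lerDl holder_coexp_ge0.
Qed.

End Main.

Theorem theorem3 (R : realType) (d : nat) (gamma : R) (hd : (1 <= d)%N)
    (hgamma : (d%:R - 1) / d%:R < gamma <= 1) :
  exists C : R, forall (omega : set 'rV[R]_d -> R) (B : set 'rV[R]_d),
    sch gamma omega -> bv_cube B ->
    `|omega B| <= C * fine (holder_norm gamma omega) * isop_ratio gamma B.
Proof.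
have /andP[hg hg1] := hgamma.
exists (3 + 16 * d%:R * (2 ^+ d * d%:R) / (1 - holder_ratio d gamma)) => omega B sw bB.
exact: charge_isop_bound.
Qed.
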